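(* (Finite-horizon Stochastic Bounded Real Lemma) Given $\gamma>0$, the system $$x(k+1)=A(k)x(k)+B_1(k)v(k)+\big(C(k)x(k)+D_1(k)v(k)\big)\omega(k),\qquad z(k)=\overline{C}(k)x(k)+\overline{D}(k)v(k),\quad k\in\mathcal{Q},$$ with $x(0)=x_0=0$ satisfies $\|\mathbb{L}\|<\gamma$ if and only if the backward operator equation $$Y^\gamma(k)=\pi_1(Y^\gamma(k+1),k)-\pi_2(Y^\gamma(k+1),k)^*\,\pi_3^\gamma(Y^\gamma(k+1),k)^{-1}\,\pi_2(Y^\gamma(k+1),k),\ \forall k\in\mathcal{Q},\qquad Y^\gamma(N+1)=0,$$ admits a solution $\{Y^\gamma(k),\ k\in\mathcal{Q}^+\}$ of operators in $\varepsilon(H)$ such that $\pi_3^\gamma(Y^\gamma(k+1),k)>0$ for all $k\in\mathcal{Q}$. Here $$\pi_1(X,k)=A(k)^*XA(k)+C(k)^*XC(k)-\overline{C}(k)^*\overline{C}(k),$$ $$\pi_2(X,k)=B_1(k)^*XA(k)+D_1(k)^*XC(k),$$ $$\pi_3^\gamma(X,k)=\gamma^2I_V-\overline{D}(k)^*\overline{D}(k)+B_1(k)^*XB_1(k)+D_1(k)^*XD_1(k).$$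
   Context: $H,V,Z$ are real separable Hilbert spaces. $L(X,Y)$ is the space of bounded linear operators $X\to Y$, $L(X)=L(X,X)$, $\varepsilon(X)$ is the set of self-adjoint elements of $L(X)$, and $*$ denotes the adjoint. For $T\in L(X)$: $T\ge 0$ means $T$ is self-adjoint and $\langle Tx,x\rangle\ge 0$ for all $x$; $T>0$ means there is $\vartheta>0$ with $T-\vartheta I_X\ge 0$. $\mathcal{Q}=\{0,1,\dots,N\}$, $\mathcal{Q}^+=\{0,1,\dots,N+1\}$. $(\Omega,\mathcal{F},P)$ is a probability space, $\{\omega(k),k\in\mathcal{Q}\}$ is a sequence of real random variables with $E[\omega(k)]=0$ and $E[\omega(k_1)\omega(k_2)]=\delta(k_1,k_2)$ (Kronecker delta). $\mathcal{F}_0=\sigma(x_0)$ (with $x_0$ deterministic) and $\mathcal{F}_k=\sigma(\omega(0),\dots,\omega(k-1))$. For $k\in\mathcal{Q}$: $A(k),C(k)\in L(H)$, $B_1(k),D_1(k)\in L(V,H)$, $\overline{C}(k)\in L(H,Z)$, $\overline{D}(k)\in L(V,Z)$, and it is assumed throughout that $\overline{D}(k)^*\overline{C}(k)=0$ for all $k\in\mathcal{Q}$. For a Hilbert space $K$, $L^2_{K^{\mathcal{Q}}}$ is the space of sequences $q=\{q(k)\}_{k\in\mathcal{Q}}$ of $K$-valued random variables, with $q(k)$ $\mathcal{F}_k$-measurable, and $\|q\|_{L^2_{K^{\mathcal{Q}}}}=(\sum_{k\in\mathcal{Q}}E[\|q(k)\|_K^2])^{1/2}<+\infty$. The perturbation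 operator $\mathbb{L}:L^2_{V^{\mathcal{Q}}}\to L^2_{Z^{\mathcal{Q}}}$ is $(\mathbb{L}(v))(k)=\overline{C}(k)x(k)+\overline{D}(k)v(k)$, where $x(\cdot)$ is the solution with disturbance $v$ and $x_0=0$, and its $H_\infty$ norm is $$\|\mathbb{L}\|=\sup_{v\in L^2_{V^{\mathcal{Q}}},\,v\ne 0,\,x_0=0}\frac{\|\mathbb{L}(v)\|_{L^2_{Z^{\mathcal{Q}}}}}{\|v\|_{L^2_{V^{\mathcal{Q}}}}}.$$
   Formalization: The noise is additionally assumed to satisfy E[ω(k)|F_k]=0 and E[ω(k)²|F_k]=1 for all k in Q (as for independent ω(k)); with E[ω(k)]=0 and E[ω(k1)ω(k2)]=δ(k1,k2) alone the equivalence is false. *)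

(* Defs.v *)
From HB Require Import structures.
From mathcomp Require Import all_boot all_order all_algebra.
From mathcomp Require Import all_classical all_reals all_analysis.
Set Implicit Arguments.
Unset Strict Implicit.
Unset Printing Implicit Defensive.
Import Order.TTheory GRing.Theory Num.Theory.
Import numFieldNormedType.Exports.
Local Open Scope classical_set_scope.
Local Open Scope ring_scope.

HB.mixin Record CompleteNormedModule_isHilbert (R : realType) H
    & CompleteNormedModule R H := {
  inner : {dot H for (@idfun R)};
  inner_normE : forall x : H, inner x x = `|x| ^+ 2
}.

#[short(type="hilbertType")]
HB.structure Definition Hilbert (R : realType) :=
  {H of CompleteNormedModule R H & CompleteNormedModule_isHilbert R H}.

Notation "⟪ x , y ⟫" := (inner x y)
  (at level 0, format "⟪ x ,  y ⟫") : ring_scope.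

Definition separable (T : topologicalType) :=
  exists2 D : set T, countable D & dense D.

Section Operators.
Context {R : realType}.
Implicit Types X Y : hilbertType R.

Definition bounded_op {X Y} : set (X -> Y) :=
  [set T | linear T /\ exists M : R, forall x, `|T x| <= M * `|x|].

(* Arbitrary only where no such [z] exists; for [T] in [bounded_op] the Riesz
   representation theorem gives existence and uniqueness. *)
Definition adjoint {X Y} (T : X -> Y) : Y -> X :=
  fun y => xget 0 [set z | forall x, ⟪T x, y⟫ = ⟪x, z⟫].

Definition selfadjoint {X} : set (X -> X) :=
  [set T | bounded_op T /\ adjoint T = T].

Definition op_ge0 {X} (T : X -> X) : Prop :=
  selfadjoint T /\ forall x, 0 <= ⟪T x, x⟫.

Definition op_gt0 {X} (T : X -> X) : Prop :=
  exists2 theta : R, 0 < theta & op_ge0 (T - theta *: (id : X -> X)).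

(* Total; it is the two-sided inverse whenever [T] is bijective, in particular
   when [op_gt0 T]. *)
Definition op_inv {X} (T : X -> X) : X -> X := 'pinv_(fun=> 0) setT T.

End Operators.

Notation "T ^†" := (adjoint T) (at level 1, format "T ^†") : ring_scope.

Section Riccati.
Context {R : realType} {H V Z : hilbertType R}.
Variables (A C : nat -> H -> H) (B1 D1 : nat -> V -> H).
Variables (Cb : nat -> H -> Z) (Db : nat -> V -> Z).

Definition pi1 (X : H -> H) (k : nat) : H -> H :=
  ((A k)^† \o X \o A k) + ((C k)^† \o X \o C k) - ((Cb k)^† \o Cb k).

Definition pi2 (X : H -> H) (k : nat) : H -> V :=
  ((B1 k)^† \o X \o A k) + ((D1 k)^† \o X \o C k).

Definition pi3 (gamma : R) (X : H -> H) (k : nat) : V -> V :=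
  gamma ^+ 2 *: (id : V -> V) - ((Db k)^† \o Db k)
  + ((B1 k)^† \o X \o B1 k) + ((D1 k)^† \o X \o D1 k).

End Riccati.

Section Stochastic.
Context {R : realType} {d : measure_display} {Omega : measurableType d}.
Variables (P : probability Omega R) (w : nat -> {RV P >-> R}).

(* The sigma-algebra generated by w(0), ..., w(k-1); [past 0] generates the
   trivial one, which is also generated by a deterministic initial state. *)
Definition past (k : nat) : set (set Omega) :=
  \bigcup_(j in `I_k) preimage_set_system setT (w j) measurable.

Definition adapted {K : hilbertType R} (k : nat) (q : Omega -> K) : Prop :=
  measurable_fun (setT : set (g_sigma_algebraType (past k)))
    (q : g_sigma_algebraType (past k) -> g_sigma_algebraType (@open K)).

Definition orthonormal_noise (N : nat) : Prop :=
  (forall k, (k <= N)%N -> 'E_P[w k] = 0)%E /\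
  (forall k1 k2, (k1 <= N)%N -> (k2 <= N)%N ->
     'E_P[fun t => (w k1 t * w k2 t)%R] = ((k1 == k2)%:R)%:E)%E.

(* E[w(k) | F_k] = 0 and E[w(k)^2 | F_k] = 1, written out on the events of F_k.
   Independence of the w(k) together with [orthonormal_noise] implies this;
   [orthonormal_noise] alone does not. *)
Definition conditionally_orthonormal (N : nat) : Prop :=
  forall k (F : set Omega), (k <= N)%N -> <<s past k >> F ->
    (\int[P]_(t in F) (w k t)%:E = 0 /\
     \int[P]_(t in F) ((w k t) ^+ 2)%:E = P F)%E.

Definition L2norm {K : hilbertType R} (N : nat) (q : nat -> Omega -> K)
    : \bar R :=
  sqrte (\sum_(k < N.+1) 'E_P[fun t => (`|q k t| ^+ 2)%R])%E.

Definition L2 {K : hilbertType R} (N : nat) : set (nat -> Omega -> K) :=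
  [set q | (forall k, (k <= N)%N -> adapted k (q k)) /\ (L2norm N q < +oo)%E].

Section System.
Context {H V Z : hilbertType R}.
Variables (A C : nat -> H -> H) (B1 D1 : nat -> V -> H).
Variables (Cb : nat -> H -> Z) (Db : nat -> V -> Z).

Fixpoint state (x0 : H) (v : nat -> Omega -> V) (k : nat) : Omega -> H :=
  if k is j.+1 then fun t =>
    A j (state x0 v j t) + B1 j (v j t)
    + w j t *: (C j (state x0 v j t) + D1 j (v j t))
  else fun=> x0.

Definition perturbation (v : nat -> Omega -> V) : nat -> Omega -> Z :=
  fun k t => Cb k (state 0 v k t) + Db k (v k t).

(* v <> 0 as an element of L^2, whose elements are identified when almost surely
   equal, is [L2norm N v != 0]. *)
Definition Hinf_norm (N : nat) : \bar R :=
  ereal_sup [set (L2norm N (perturbation v) / L2norm N v)%E |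
             v in [set v | L2 N v /\ L2norm N v != 0%E]].

End System.
End Stochastic.

(* Main.v *)
Require Import Defs.
From mathcomp Require Import all_boot all_order all_algebra.
From mathcomp Require Import all_classical all_reals all_analysis.
From mathcomp Require Import measurable_realfun ring lra.
Set Implicit Arguments.
Unset Strict Implicit.
Unset Printing Implicit Defensive.
Import Order.TTheory GRing.Theory Num.Theory.
Import numFieldNormedType.Exports.
Local Open Scope classical_set_scope.
Local Open Scope ring_scope.

(** Write [x] for the state with [x 0 = 0], [z] for the output, and let the cost
    of a disturbance [v] be the sum over the stages of
    [gamma ^ 2 E|v k| ^ 2 - E|z k| ^ 2].  The norm is below [gamma] exactly when
    the cost dominates a positive multiple of the energy of [v]
    (Hinf_norm_ltP); both directions compare the cost with the quadratic forms
    of the Riccati operators.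

    The comparison rests on two identities.  The noise at time [k] has
    conditional mean 0 and conditional variance 1, so for a selfadjoint [Y] and
    square integrable [a], [b] depending on the past,
    [E⟪Y (a + w b), a + w b⟫ = E⟪Y a, a⟫ + E⟪Y b, b⟫] (quadratic_noise).  And
    one stage of the cost plus the form of [Y k.+1] at the next state is, by
    completing the square, the form of [Y k] at [x] plus that of [pi3] at
    [v + gain x] (complete_square).

    If the Riccati equation has a solution, the sum of these identities
    telescopes and the cost is the sum of the means of the forms of [pi3] at
    [u = v + gain x] (cost_slack).  It is coercive in [u], and since [v] is
    recovered from [u] causally, with energy bounds propagated stage by stage,
    it is coercive in [v] (cost_coercive).

    Conversely the operators are constructed backwards from [Y N.+1 = 0], and
    the only obstruction is the positivity of [pi3].  When [Y k.+1], ..., are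
    known, a disturbance that is silent before stage [k], equal to a vector [u]
    at stage [k] and given by the optimal feedback later has cost
    [⟪pi3 u, u⟫] and energy at least [|u| ^ 2] (test_disturbance), so that
    [pi3] inherits the gap of the cost (riccati_solvable).

    The operator theory reduces to one variational lemma, that a coercive
    symmetric operator is onto (coercive_solvable): it yields adjoints and
    inverses.  The conditional moments of the noise, given on events, extend to
    integrable functions of the past by monotone approximation
    (eq_integral_weight, noise_moments); separability makes sums of measurable
    vectors measurable (borel_fun2). *)

(** * Inner products *)

Section HilbertBasics.
Context {R : realType}.
Implicit Types X Y : hilbertType R.

Lemma innerDl X (x y z : X) : ⟪x + y, z⟫ = ⟪x, z⟫ + ⟪y, z⟫.
Proof. exact: linearDl. Qed.

Lemma innerDr X (x y z : X) : ⟪z, x + y⟫ = ⟪z, x⟫ + ⟪z, y⟫.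
Proof. exact: linearDr. Qed.

Lemma innerZl X a (x z : X) : ⟪a *: x, z⟫ = a * ⟪x, z⟫.
Proof. exact: linearZl_LR. Qed.

Lemma innerZr X a (x z : X) : ⟪z, a *: x⟫ = a * ⟪z, x⟫.
Proof. exact: linearZr_LR. Qed.

Lemma innerNl X (x z : X) : ⟪- x, z⟫ = - ⟪x, z⟫.
Proof. exact: linearNl. Qed.

Lemma innerNr X (x z : X) : ⟪z, - x⟫ = - ⟪z, x⟫.
Proof. exact: linearNr. Qed.

Lemma inner0l X (z : X) : ⟪0, z⟫ = 0.
Proof. exact: linear0l. Qed.

Lemma inner0r X (z : X) : ⟪z, 0⟫ = 0.
Proof. exact: linear0r. Qed.

Lemma innerC X (x y : X) : ⟪x, y⟫ = ⟪y, x⟫.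
Proof. by rewrite hermC expr0 mul1r. Qed.

Definition innerE := (innerDl, innerDr, innerNl, innerNr, innerZl, innerZr,
  inner0l, inner0r).

Lemma inner_ext X (x y : X) : (forall z, ⟪x, z⟫ = ⟪y, z⟫) -> x = y.
Proof.
move=> xy; apply/eqP; rewrite -subr_eq0 -normr_eq0 -sqrf_eq0 -inner_normE.
by rewrite innerDl innerNl xy subrr.
Qed.

Lemma CauchySchwarz X (x y : X) : `|⟪x, y⟫| <= `|x| * `|y|.
Proof.
have [->|y0] := eqVneq y 0; first by rewrite inner0r !normr0 mulr0.
have ny : 0 < `|y| by rewrite normr_gt0.
rewrite -(@ler_pXn2r _ 2) ?nnegrE ?mulr_ge0//.
rewrite real_normK ?num_real// exprMn.
have := sqr_ge0 `|(`|y| ^+ 2) *: x - ⟪x, y⟫ *: y|.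
rewrite -inner_normE !innerE (innerC y x) !inner_normE.
set a := `|x| ^+ 2; set c := ⟪x, y⟫.
have : 0 < `|y| ^+ 2 by rewrite exprn_gt0.
set b := `|y| ^+ 2 => b0 h.
have : 0 <= b * (a * b - c ^+ 2) by apply: le_trans h _; lra.
by rewrite pmulr_rge0// subr_ge0.
Qed.

Lemma normD_sqr X (x y : X) :
  `|x + y| ^+ 2 = `|x| ^+ 2 + 2 * ⟪x, y⟫ + `|y| ^+ 2.
Proof. by rewrite -!inner_normE !innerE (innerC y x); lra. Qed.

Lemma normD_sqr_le X (x y : X) :
  `|x + y| ^+ 2 <= 2 * `|x| ^+ 2 + 2 * `|y| ^+ 2.
Proof.
have := sqr_ge0 `|x - y|.
by rewrite normD_sqr normD_sqr innerNr normrN; lra.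
Qed.

End HilbertBasics.

(** * Bounded operators *)

Section BoundedOperators.
Context {R : realType}.
Implicit Types X Y W : hilbertType R.

Section Linearity.
Variables (X Y : hilbertType R) (T : X -> Y).
Hypothesis bT : bounded_op T.

Lemma bopD x y : T (x + y) = T x + T y.
Proof. by have := bT.1 1 x y; rewrite !scale1r. Qed.

Lemma bop0 : T 0 = 0.
Proof. by apply: (addIr (T 0)); rewrite -bopD !add0r. Qed.

Lemma bopZ a x : T (a *: x) = a *: T x.
Proof. by have := bT.1 a x 0; rewrite bop0 !addr0. Qed.

Lemma bopN x : T (- x) = - T x.
Proof. by rewrite -scaleN1r bopZ scaleN1r. Qed.

Lemma bop_bound : exists2 M : R, 0 < M & forall x, `|T x| <= M * `|x|.
Proof.
have [_ [M HM]] := bT; exists (`|M| + 1); first by rewrite ltr_wpDl.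
move=> x; apply: le_trans (HM x) _; apply: ler_wpM2r => //.
by rewrite (le_trans (ler_norm M))// lerDl.
Qed.

Lemma bop_continuous : continuous T.
Proof.
have [M M0 HM] := bop_bound; move=> x; apply/cvgrPdist_lt => e e0.
near=> y; rewrite -bopN -bopD (le_lt_trans (HM _))// mulrC -ltr_pdivlMr//.
near: y; apply: cvgr_dist_lt; [exact: cvg_id|exact: divr_gt0].
Unshelve. all: end_near. Qed.

End Linearity.

Lemma bounded_opP X Y (T : X -> Y) M :
  (forall x y, T (x + y) = T x + T y) -> (forall a x, T (a *: x) = a *: T x) ->
  (forall x, `|T x| <= M * `|x|) -> bounded_op T.
Proof.
by move=> TD TZ TM; split; [move=> a x y; rewrite TD TZ|exists M].
Qed.

Lemma bounded_op_id X : bounded_op (id : X -> X).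
Proof. by apply: (@bounded_opP _ _ _ 1) => // x; rewrite mul1r. Qed.

Lemma bounded_op0 X Y : bounded_op (0 : X -> Y).
Proof.
apply: (@bounded_opP _ _ _ 0) => [x y|a x|x].
- by rewrite addr0.
- by rewrite scaler0.
- by rewrite normr0 mul0r.
Qed.

Lemma bounded_opD X Y (S T : X -> Y) :
  bounded_op S -> bounded_op T -> bounded_op (S + T).
Proof.
move=> bS bT; have [M _ HM] := bop_bound bS; have [M' _ HM'] := bop_bound bT.
apply: (@bounded_opP _ _ _ (M + M')) => [x y|a x|x].
- by rewrite /= !addrfctE (bopD bS) (bopD bT) addrACA.
- by rewrite /= !addrfctE (bopZ bS) (bopZ bT) scalerDr.
- by rewrite !addrfctE mulrDl (le_trans (ler_normD _ _))// lerD.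
Qed.

Lemma bounded_opZ X Y a (T : X -> Y) : bounded_op T -> bounded_op (a *: T).
Proof.
move=> bT; have [M _ HM] := bop_bound bT.
apply: (@bounded_opP _ _ _ (`|a| * M)) => [x y|b x|x]; rewrite !scalrfctE.
- by rewrite (bopD bT) scalerDr.
- by rewrite (bopZ bT) !scalerA mulrC.
- by rewrite normrZ -mulrA ler_wpM2l.
Qed.

Lemma bounded_opN X Y (T : X -> Y) : bounded_op T -> bounded_op (- T).
Proof. by move=> /(bounded_opZ (-1)); rewrite scaleN1r. Qed.

Lemma bounded_op_comp X Y W (S : Y -> W) (T : X -> Y) :
  bounded_op S -> bounded_op T -> bounded_op (S \o T).
Proof.
move=> bS bT; have [M M0 HM] := bop_bound bS; have [M' _ HM'] := bop_bound bT.
apply: (@bounded_opP _ _ _ (M * M')) => [x y|a x|x] /=.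
- by rewrite (bopD bT) (bopD bS).
- by rewrite (bopZ bT) (bopZ bS).
- by rewrite (le_trans (HM _))// -mulrA ler_pM2l.
Qed.

End BoundedOperators.

(** * Adjoints and inverses *)

Section Variational.
Context {R : realType}.
Implicit Types X Y : hilbertType R.

(** The minimiser of [⟪T x, x⟫ - 2 f x] solves the equation: the parallelogram
    identity for the form of [T] makes a minimising sequence Cauchy, and the
    first variation at the limit vanishes.  Both the Riesz theorem ([T = id])
    and the invertibility of positive operators are instances. *)
Lemma coercive_solvable X (T : X -> X) (f : X -> R) (theta M : R) :
  bounded_op T -> (forall x y, ⟪T x, y⟫ = ⟪x, T y⟫) ->
  0 < theta -> (forall x, theta * `|x| ^+ 2 <= ⟪T x, x⟫) ->
  (forall x y, f (x + y) = f x + f y) -> (forall a x, f (a *: x) = a * f x) ->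
  (forall x, `|f x| <= M * `|x|) ->
  exists z, forall y, ⟪T z, y⟫ = f y.
Proof.
move=> bT sT th0 coer fD fZ fM.
have fN x : f (- x) = - f x by rewrite -scaleN1r fZ mulN1r.
pose J x := ⟪T x, x⟫ - 2 * f x.
have J_lb x : - (M ^+ 2 / theta) <= J x.
  rewrite /J; have h1 := coer x; have h2 := fM x.
  have h3 : f x <= M * `|x| := le_trans (ler_norm _) h2.
  have h4 := sqr_ge0 (theta * `|x| - M).
  have : 0 <= theta * `|x| ^+ 2 - 2 * (M * `|x|) + M ^+ 2 / theta.
    rewrite -(pmulr_rge0 _ th0) [leRHS](_ : _ = (theta * `|x| - M) ^+ 2)//.
    by field; rewrite gt_eqF.
  by lra.
have hE : has_inf (range J).
  split; first by exists (J 0), 0.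
  by exists (- (M ^+ 2 / theta)) => _ [x _ <-].
set m := inf (range J).
have m_le x : m <= J x by apply: ge_inf; [case: hE|exists x].
have /choice[u uP] : forall n : nat, exists x, J x < m + n.+1%:R^-1.
  move=> n; have n0 : 0 < n.+1%:R^-1 :> R by rewrite invr_gt0.
  by have [_ [x _ <-] xlt] := inf_adherent n0 hE; exists x.
have para x y : theta * `|x - y| ^+ 2 <= 2 * J x + 2 * J y - 4 * m.
  apply: le_trans (coer _) _.
  have := m_le (2^-1 *: (x + y)); rewrite /J.
  rewrite (bopD bT) (bopN bT) (bopZ bT) (bopD bT) fZ fD !innerE.
  by rewrite (sT y x) (innerC y (T x)); lra.
have u_close n k : (n <= k)%N -> `|u n - u k| ^+ 2 <= 4 / theta * n.+1%:R^-1.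
  move=> nk; rewrite -(ler_pM2l th0).
  rewrite [leRHS](_ : _ = 4 * n.+1%:R^-1); last first.
    by move: (n.+1%:R^-1) => r; field; rewrite gt_eqF.
  apply: le_trans (para _ _) _.
  have k_n : k.+1%:R^-1 <= n.+1%:R^-1 :> R.
    by rewrite lef_pV2 ?posrE ?ltr0n// ler_nat.
  move: (uP n) (uP k) k_n; move: n.+1%:R^-1 k.+1%:R^-1 (J (u n)) (J (u k)).
  by move=> *; lra.
have u_cvg : cvgn u.
  apply/cauchy_cvgP/cauchyP => e e0.
  pose d := e ^+ 2 * theta / 4.
  have d0 : 0 < d by rewrite /d !mulr_gt0// ?exprn_gt0 ?invr_gt0.
  have [n _ nP] : \forall n \near \oo, n.+1%:R^-1 < d.
    by apply: cvgr_lt d0; exact: cvg_harmonic.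
  exists (u n); exists n => // k /= nk.
  rewrite -ball_normE /= -(@ltr_pXn2r _ 2) ?nnegrE ?(ltW e0)//.
  apply: le_lt_trans (u_close _ _ nk) _.
  have := nP n (leqnn n); rewrite -(@ltr_pM2l _ (4 / theta)) ?divr_gt0//.
  move=> h; apply: lt_le_trans h _; rewrite /d le_eqVlt; apply/orP; left.
  by apply/eqP; field; rewrite gt_eqF.
pose z := limn u.
have Jz : J z = m.
  have Jcvg : J \o u @ \oo --> J z.
    rewrite /J; apply/cvgrPdist_le => /= e e0.
    have [K K0 HK] := bop_bound bT.
    (* the increment of J at z is bounded by a multiple of |z - x| near z *)
    pose c := K * (2 * `|z| + 1) + 2 * `|M|.
    have c0 : 0 < c + 1 by rewrite
      ltr_wpDl// addr_ge0// ?mulr_ge0// ?addr_ge0// ?mulr_ge0// ltW.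
    near=> n.
    have zu1 : `|z - u n| <= 1.
      near: n; apply: cvgr_dist_le; [exact: u_cvg|exact: ltr01].
    have zu : `|z - u n| <= e / (c + 1).
      near: n; apply: cvgr_dist_le; [exact: u_cvg|exact: divr_gt0].
    set x := u n in zu1 zu *.
    have -> : ⟪T z, z⟫ - 2 * f z - (⟪T x, x⟫ - 2 * f x) =
        ⟪T (z - x), z + x⟫ - 2 * f (z - x).
      rewrite (bopD bT) (bopN bT) fD fN !innerE (sT x z).
      by rewrite (innerC x (T z)); lra.
    apply: le_trans (ler_normB _ _) _.
    have h1 : `|⟪T (z - x), z + x⟫| <= K * `|z - x| * (2 * `|z| + 1).
      apply: le_trans (CauchySchwarz _ _) _; apply: ler_pM => //.
      have -> : z + x = 2 *: z - (z - x).
        by rewrite scaler_nat mulr2n opprB addrACA subrr addr0.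
      apply: le_trans (ler_normB _ _) _.
      by rewrite normrZ ger0_norm// lerD2l.
    have h2 : `|2 * f (z - x)| <= 2 * `|M| * `|z - x|.
      rewrite normrM ger0_norm// -mulrA ler_pM2l// (le_trans (fM _))//.
      by rewrite ler_wpM2r// ler_norm.
    have h3 : (c + 1) * `|z - x| <= e by rewrite mulrC -ler_pdivlMr.
    by have := normr_ge0 (z - x); move: h1 h2 h3; rewrite /c; lra.
  apply/eqP; rewrite eq_le m_le andbT.
  have m_cvg : (fun n : nat => m + n.+1%:R^-1) @ \oo --> m.
    by rewrite -[X in _ --> X]addr0; apply: cvgD; [exact: cvg_cst|exact: cvg_harmonic].
  apply: ler_cvg_to Jcvg m_cvg _.
  by near=> n => /=; exact: ltW (uP n).
exists z => y; set a := ⟪T y, y⟫; set b := ⟪T z, y⟫ - f y.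
have var t : 0 <= t ^+ 2 * a + 2 * t * b.
  have := m_le (z + t *: y); rewrite -Jz /J /a /b.
  rewrite (bopD bT) (bopZ bT) fD fZ !innerE (sT y z) (innerC y (T z)).
  by lra.
have a0 : 0 <= a by rewrite /a (le_trans _ (coer y))// mulr_ge0// ?ltW.
apply/eqP; rewrite -subr_eq0 -/b; apply/eqP.
(* near the minimiser -b / a of the parabola; a may vanish *)
have := var (- b / (a + 1)).
rewrite (_ : _ + _ = - (b ^+ 2 * (a + 2)) / (a + 1) ^+ 2); last first.
  by field; rewrite gt_eqF// ltr_wpDl.
rewrite mulNr oppr_ge0 pmulr_lle0 ?invr_gt0 ?exprn_gt0 ?ltr_wpDl//.
rewrite pmulr_lle0 ?ltr_wpDl// => b2.
by apply/eqP; rewrite -sqrf_eq0 eq_le b2 sqr_ge0.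
Unshelve. all: end_near. Qed.

(** The Riesz theorem for the functional [⟪T _, y⟫] produces the witness that
    the definition of the adjoint chooses. *)
Lemma adjointP X Y (T : X -> Y) : bounded_op T ->
  forall x y, ⟪T x, y⟫ = ⟪x, T^† y⟫.
Proof.
move=> bT x y; have [M M0 HM] := bop_bound bT.
suff : exists z, forall x, ⟪T x, y⟫ = ⟪x, z⟫.
  by move=> /(@xgetPex _ 0 [set z | forall x, ⟪T x, y⟫ = ⟪x, z⟫]).
have [|||||||z zP] := @coercive_solvable X id (fun x => ⟪T x, y⟫) 1 (M * `|y|).
- exact: bounded_op_id.
- by [].
- by [].
- by move=> x'; rewrite mul1r inner_normE.
- by move=> x1 x2; rewrite (bopD bT) innerDl.
- by move=> a x'; rewrite (bopZ bT) innerZl.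
- by move=> x'; rewrite (le_trans (CauchySchwarz _ _))// mulrAC ler_wpM2r.
- by exists z => x'; rewrite -zP innerC.
Qed.

Lemma adjoint_uniq X Y (T : X -> Y) (S : Y -> X) : bounded_op T ->
  (forall x y, ⟪T x, y⟫ = ⟪x, S y⟫) -> T^† = S.
Proof.
move=> bT TS; apply/funext => y; apply: inner_ext => x.
by rewrite innerC -(adjointP bT) TS innerC.
Qed.

Lemma bounded_op_adjoint X Y (T : X -> Y) : bounded_op T -> bounded_op T^†.
Proof.
move=> bT; have [M M0 HM] := bop_bound bT; have TP := adjointP bT.
apply: (@bounded_opP _ _ _ _ M) => [x y|a x|y].
- by apply: inner_ext => z; rewrite innerC -TP !innerE !TP !(innerC z).
- by apply: inner_ext => z; rewrite innerC -TP !innerE !TP !(innerC z).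
- have [->|y0] := eqVneq (T^† y) 0; first by rewrite normr0 mulr_ge0// ltW.
  have ny : 0 < `|T^† y| by rewrite normr_gt0.
  rewrite -(ler_pM2l ny) -expr2 -inner_normE -TP.
  apply: le_trans (ler_norm _) _; apply: le_trans (CauchySchwarz _ _) _.
  by rewrite mulrCA mulrA ler_wpM2r.
Qed.

Lemma selfadjointP X (T : X -> X) :
  selfadjoint T <-> bounded_op T /\ forall x y, ⟪T x, y⟫ = ⟪x, T y⟫.
Proof.
split=> -[bT sT]; split=> //; last exact: adjoint_uniq.
by move=> x y; rewrite (adjointP bT) sT.
Qed.

Section PositiveInverse.
Variables (X : hilbertType R) (T : X -> X).
Hypothesis T_gt0 : op_gt0 T.

Lemma op_gt0P : exists2 theta : R, 0 < theta &
  forall x, theta * `|x| ^+ 2 <= ⟪T x, x⟫.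
Proof.
have [theta th0 [_ hT]] := T_gt0; exists theta => // x.
have := hT x; rewrite !addrfctE !opprfctE !scalrfctE !innerE inner_normE.
by rewrite subr_ge0.
Qed.

Lemma op_gt0_selfadjoint : selfadjoint T.
Proof.
have [theta th0 [/selfadjointP[bS sS] _]] := T_gt0.
have TE : T = (T - theta *: (id : X -> X)) + theta *: (id : X -> X).
  by rewrite addrNK.
apply/selfadjointP; split.
  by rewrite TE; apply: bounded_opD => //; apply/bounded_opZ/bounded_op_id.
move=> x y; have := sS x y.
by rewrite !addrfctE !opprfctE !scalrfctE !innerE => /addIr.
Qed.

Let bT : bounded_op T. Proof. by have [] := op_gt0_selfadjoint. Qed.

Let sT x y : ⟪T x, y⟫ = ⟪x, T y⟫.
Proof. by have /selfadjointP[_ ->] := op_gt0_selfadjoint. Qed.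

(** A coercive operator is onto by the variational argument, so that its partial
    inverse is a right inverse everywhere. *)
Lemma op_invK y : T (op_inv T y) = y.
Proof.
have [theta th0 coer] := op_gt0P.
have [|||||||z zP] := @coercive_solvable X T (fun x => ⟪y, x⟫) theta `|y| => //.
- by move=> x1 x2; rewrite innerDr.
- by move=> a x'; rewrite innerZr.
- by move=> x; exact: CauchySchwarz.
- rewrite /op_inv; apply: pinvK; rewrite inE; exists z => //.
  exact: inner_ext.
Qed.

Lemma op_inv_selfadjoint : selfadjoint (op_inv T).
Proof.
have [theta th0 coer] := op_gt0P.
have inj x y : T x = T y -> x = y.
  move=> Txy; apply/eqP; rewrite -subr_eq0 -normr_eq0 -sqrf_eq0.
  have := coer (x - y); rewrite (bopD bT) (bopN bT) Txy addrN inner0l.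
  by rewrite pmulr_rle0// => h; rewrite eq_le h sqr_ge0.
apply/selfadjointP; split; last first.
  by move=> x y; rewrite -{1}(op_invK y) -sT op_invK.
apply: (@bounded_opP _ _ _ _ theta^-1) => [x y|a x|x].
- by apply: inj; rewrite (bopD bT) !op_invK.
- by apply: inj; rewrite (bopZ bT) !op_invK.
- set z := op_inv T x; have [->|z0] := eqVneq z 0.
    by rewrite normr0 mulr_ge0// invr_ge0 ltW.
  have nz : 0 < `|z| by rewrite normr_gt0.
  rewrite mulrC ler_pdivlMr// -(ler_pM2l nz).
  have := coer z; rewrite op_invK => h.
  rewrite mulrA -expr2 mulrC; apply: le_trans h _.
  by rewrite (le_trans (ler_norm _))// (le_trans (CauchySchwarz _ _))// mulrC.
Qed.

End PositiveInverse.

Lemma op_gt0I X (T : X -> X) (theta : R) : 0 < theta -> selfadjoint T ->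
  (forall x, theta * `|x| ^+ 2 <= ⟪T x, x⟫) -> op_gt0 T.
Proof.
move=> th0 /selfadjointP[bT sT] coer; exists theta => //; split.
  apply/selfadjointP; split.
    by apply: bounded_opD => //; apply/bounded_opN/bounded_opZ/bounded_op_id.
  move=> x y.
  by rewrite !addrfctE !opprfctE !scalrfctE !innerE sT.
move=> x; rewrite !addrfctE !opprfctE !scalrfctE !innerE inner_normE.
by rewrite subr_ge0.
Qed.

End Variational.

(** * Measurability with respect to open sets *)

Section BorelFunctions.
Context {R : realType}.

(** Testing on open sets needs no measurable structure on the codomain, and
    lets one carrier be the domain for each of the sigma-algebras of the
    filtration. *)
Definition borel_fun d (T : measurableType d) (K : topologicalType)
  (q : T -> K) := forall O, open O -> measurable (q @^-1` O).

Lemma borel_fun_comp d (T : measurableType d) (K L : topologicalType)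
  (F : K -> L) (q : T -> K) :
  continuous F -> borel_fun q -> borel_fun (F \o q).
Proof. by move=> /continuousP cF mq O /cF oO; exact: mq oO. Qed.

Lemma borel_fun_cst d (T : measurableType d) (K : topologicalType) (c : K) :
  borel_fun (cst c : T -> K).
Proof.
move=> O oO; have [cO|cO] := pselect (O c).
- by rewrite preimage_cst ifT ?inE//; exact: measurableT.
- by rewrite preimage_cst ifF ?memNset//; exact: measurable0.
Qed.

Lemma borel_fun_real d (T : measurableType d) (q : T -> R) :
  borel_fun q <-> measurable_fun setT q.
Proof.
split=> mq.
- apply: (measurability (@RGenOpens.G R)).
    exact: RGenOpens.measurableE.
  move=> _ [_ [a [b ->]] <-]; rewrite setTI; apply: mq; exact: interval_open.
- move=> O oO; rewrite -[X in measurable X]setTI; apply: mq => //.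
  exact: open_measurable.
Qed.

(** Separability restated so that open sets become unions indexed by [nat]. *)
Lemma separable_seq (K : normedModType R) : separable K ->
  exists e : nat -> K, forall x r, 0 < r -> exists n, ball (e n) r x.
Proof.
move=> [D /countable_injP[f injf] dD].
exists (fun n => xget 0 [set x | D x /\ f x = n]) => x r r0.
have [|y [xy Dy]] := dD (ball x r) _ (ball_open x r).
  by exists x; exact: ballxx.
exists (f y); have := @xgetPex _ 0 [set z | D z /\ f z = f y].
case; first by exists y.
move=> Dz fz; suff -> : xget 0 [set z | D z /\ f z = f y] = y by exact: ball_sym.
by apply: injf => //; rewrite inE.
Qed.

(** Separability enters here: an open set of the product is a countable union
    of open boxes, so that a continuous function of two measurable maps is
    measurable. *)
Lemma borel_fun2 d (T : measurableType d) (K1 K2 : normedModType R)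
  (L : topologicalType) (F : K1 * K2 -> L) (f : T -> K1) (g : T -> K2) :
  separable K1 -> separable K2 -> continuous F ->
  borel_fun f -> borel_fun g -> borel_fun (fun t => F (f t, g t)).
Proof.
move=> /separable_seq[a aP] /separable_seq[b bP] /continuousP cF mf mg O oO.
pose r (n : nat) : R := n.+1%:R^-1.
have r0 n : 0 < r n by rewrite invr_gt0.
have -> : (fun t => F (f t, g t)) @^-1` O = \bigcup_i \bigcup_j
    \bigcup_(n in [set n | ball (a i) (r n) `*` ball (b j) (r n) `<=` F @^-1` O])
      (f @^-1` ball (a i) (r n) `&` g @^-1` ball (b j) (r n)).
  apply/seteqP; split=> [t /= Ot|t [i _ [j _ [n /= sub [ft gt]]]]]; last first.
    by apply: (sub (f t, g t)).
  have := cF _ oO; rewrite openE => /(_ (f t, g t) Ot).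
  rewrite /interior /= => -[[A B] /= [/nbhs_ballP[e1 /= e10 H1]
    /nbhs_ballP[e2 /= e20 H2]] AB].
  have [n] : exists n, r n < Num.min e1 e2 / 2.
    have e0 : 0 < Num.min e1 e2 / 2 by rewrite divr_gt0// lt_min e10.
    have [n _ nP] : \forall n \near \oo, r n < Num.min e1 e2 / 2.
      by apply: cvgr_lt e0; exact: cvg_harmonic.
    by exists n; apply: nP => /=.
  rewrite ltr_pdivlMr// mulr_natr mulr2n lt_min => /andP[n1 n2].
  have [i fi] := aP (f t) _ (r0 n); have [j gj] := bP (g t) _ (r0 n).
  exists i => //; exists j => //; exists n => //= -[x y] [/= ax by_].
  apply: AB; split => /=.
  - apply: H1; apply: le_ball (ltW n1) _ _.
    by apply: ball_triangle ax; exact: ball_sym.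
  - apply: H2; apply: le_ball (ltW n2) _ _.
    by apply: ball_triangle by_; exact: ball_sym.
apply: bigcup_measurable => i _; apply: bigcup_measurable => j _.
apply: bigcup_measurable => n _; apply: measurableI.
- by apply: mf; exact: ball_open.
- by apply: mg; exact: ball_open.
Qed.

Lemma separable_real : separable R.
Proof.
exists (@ratr R @` setT); last exact: dense_rat.
exact: sub_countable (card_image_le _ _) (countableP _).
Qed.

End BorelFunctions.

(** * Integrals against weights that agree on events *)

Section WeightedIntegral.
Context {R : realType} d d' (T : measurableType d) (T' : measurableType d').
Variables (mu : {measure set T -> \bar R}) (phi : T -> T').
Hypothesis mphi : measurable_fun setT phi.
Local Open Scope ereal_scope.
Import HBNNSimple.

Let integral_simple (h : {nnsfun T' >-> R}) (g : T -> R) :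
  measurable_fun setT g -> (forall t, 0 <= g t)%R ->
  \int[mu]_t (h (phi t) * g t)%:E = \sum_(y \in range h)
    (y%:E * \int[mu]_(t in phi @^-1` (h @^-1` [set y])) (g t)%:E).
Proof.
move=> mg g0.
transitivity (\int[mu]_t (\sum_(y \in range h)
    (y * (\1_(h @^-1` [set y]) (phi t) * g t))%:E)).
  apply: eq_integral => t _; rewrite {1}(fimfunE h (phi t)) fsumEFin//.
  congr EFin; rewrite mulrC mulr_fsumr//.
  by apply: eq_fsbigr => y _; rewrite mulrC mulrA.
have mi y : measurable_fun setT (fun t => \1_(h @^-1` [set y]) (phi t) * g t)%R.
  by apply: measurable_funM => //; exact: measurableT_comp.
rewrite ge0_integral_fsum//; last 2 first.
- by move=> y; apply/measurable_EFinP; apply: measurable_funM.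
- move=> y t _; rewrite lee_fin mulrA mulr_ge0//.
  by have := nnfun_muleindic_ge0 h y (phi t); rewrite -EFinM lee_fin.
apply: eq_fsbigr => y /set_mem[z _ <-].
under eq_integral do rewrite EFinM.
rewrite ge0_integralZl//; last 3 first.
- by apply/measurable_EFinP; exact: mi.
- by move=> t _; rewrite lee_fin mulr_ge0.
- by rewrite lee_fin.
congr (_ * _); rewrite [RHS]integral_mkcond; apply: eq_integral => t _.
rewrite patchE indicE; case: ifPn; rewrite !(inE, notin_setE) /= => ht.
- by rewrite mem_set//= mul1r.
- by rewrite memNset//= mul0r.
Qed.

(** Equality on events extends to nonnegative functions by monotone
    approximation with simple functions; with [phi] the identity into a coarser
    sigma-algebra and [g2] constant, this is [E[f g1] = E[f E[g1 | F]]]. *)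
Lemma eq_integral_weight (g1 g2 : T -> R) (f : T' -> R) :
  measurable_fun setT g1 -> measurable_fun setT g2 ->
  (forall t, 0 <= g1 t)%R -> (forall t, 0 <= g2 t)%R ->
  (forall F, measurable F -> \int[mu]_(t in phi @^-1` F) (g1 t)%:E =
                             \int[mu]_(t in phi @^-1` F) (g2 t)%:E) ->
  measurable_fun setT f -> (forall t, 0 <= f t)%R ->
  \int[mu]_t (f (phi t) * g1 t)%:E = \int[mu]_t (f (phi t) * g2 t)%:E.
Proof.
move=> mg1 mg2 g10 g20 g12 mf f0.
have mf' : measurable_fun setT (EFin \o f) by apply/measurable_EFinP.
pose h := nnsfun_approx measurableT mf'.
have cvg_h (g : T -> R) : measurable_fun setT g -> (forall t, 0 <= g t)%R ->
    \int[mu]_t (h n (phi t) * g t)%:E @[n --> \oo] --> \int[mu]_t (f (phi t) * g t)%:E.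
  move=> mg g0.
  pose F n t := (h n (phi t) * g t)%:E.
  have := @cvg_monotone_convergence _ _ _ mu setT measurableT F.
  have -> : \int[mu]_t (f (phi t) * g t)%:E = \int[mu]_t limn (F ^~ t).
    apply: eq_integral => t _; apply/esym/cvg_lim => //.
    rewrite /F EFinM; under eq_fun do rewrite EFinM.
    apply: cvgeZr => //.
    by apply: cvg_nnsfun_approx => //= x _; rewrite lee_fin.
  apply.
  - move=> n; apply/measurable_EFinP; apply: measurable_funM => //.
    by apply: measurableT_comp.
  - by move=> n t _; rewrite lee_fin mulr_ge0.
  - move=> t _ m n mn; rewrite lee_fin ler_wpM2r//.
    exact/lefP/nd_nnsfun_approx.
apply: (@cvg_unique _ _ (\int[mu]_t (h n (phi t) * g1 t)%:E @[n --> \oo])) => //.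
  exact: cvg_h.
have -> : (fun n => \int[mu]_t (h n (phi t) * g1 t)%:E) =
          (fun n => \int[mu]_t (h n (phi t) * g2 t)%:E).
  apply/funext => n; rewrite !integral_simple//; apply: eq_fsbigr => y _.
  by rewrite g12//; exact: measurable_sfunP.
exact: cvg_h.
Qed.

End WeightedIntegral.

(** * Integrable real random variables *)

Section RealIntegrable.
Context {R : realType} {d : measure_display} {Omega : measurableType d}.
Variable P : probability Omega R.

Local Notation integ f := (P.-integrable setT (EFin \o (f : Omega -> R))).
Local Notation E f := (Rintegral P setT f).

Lemma int_le (f g : Omega -> R) : measurable_fun setT f -> integ g ->
  (forall t, `|f t| <= g t) -> integ f.
Proof.
move=> mf ig fg; apply: le_integrable ig => //; first exact/measurable_EFinP.
move=> t _ /=; rewrite lee_fin (le_trans (fg t))//; exact: ler_norm.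
Qed.

Lemma int_norm (f : Omega -> R) : integ f -> integ (fun t => `|f t|).
Proof. by move=> fi; exact: (integrable_norm fi). Qed.

Lemma int_cst (c : R) : integ (fun=> c).
Proof. exact: finite_measure_integrable_cst. Qed.

Lemma intD (f g : Omega -> R) : integ f -> integ g -> integ (fun t => f t + g t).
Proof. by move=> fi gi; exact: (integrableD measurableT fi gi). Qed.

Lemma intB (f g : Omega -> R) : integ f -> integ g -> integ (fun t => f t - g t).
Proof. by move=> fi gi; exact: (integrableB measurableT fi gi). Qed.

Lemma intZ c (f : Omega -> R) : integ f -> integ (fun t => c * f t).
Proof. by move=> fi; exact: (integrableZl measurableT c fi). Qed.

Lemma ED (f g : Omega -> R) : integ f -> integ g ->
  E (fun t => f t + g t) = E f + E g.
Proof. exact: RintegralD. Qed.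

Lemma EB (f g : Omega -> R) : integ f -> integ g ->
  E (fun t => f t - g t) = E f - E g.
Proof. exact: RintegralB. Qed.

Lemma EZ c (f : Omega -> R) : integ f -> E (fun t => c * f t) = c * E f.
Proof. by move=> fi; exact: RintegralZl. Qed.

Lemma E_cst c : E (fun=> c) = c.
Proof. by rewrite Rintegral_cst// [X in fine X]probability_setT mulr1. Qed.

Lemma E_le (f g : Omega -> R) : integ f -> integ g -> (forall t, f t <= g t) ->
  E f <= E g.
Proof. by move=> fi gi fg; apply: le_Rintegral. Qed.

Lemma E_ge0 (f : Omega -> R) : (forall t, 0 <= f t) -> 0 <= E f.
Proof. by move=> f0; apply: Rintegral_ge0. Qed.

Lemma integral_EFin (f : Omega -> R) : integ f ->
  (\int[P]_t (f t)%:E)%E = (E f)%:E.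
Proof. by move=> fi; rewrite /Rintegral fineK//; exact: integrable_fin_num. Qed.

Lemma int_ge0P (f : Omega -> R) : measurable_fun setT f ->
  (forall t, 0 <= f t) -> (\int[P]_t (f t)%:E < +oo)%E -> integ f.
Proof.
move=> mf f0 fi; apply/integrableP; split; first exact/measurable_EFinP.
by under eq_integral do rewrite /= ger0_norm//.
Qed.

End RealIntegrable.

(** * Moments of the noise given the past *)

Section Noise.
Context {R : realType} {d : measure_display} {Omega : measurableType d}.
Variables (P : probability Omega R) (w : nat -> {RV P >-> R}).

Local Notation integ f := (P.-integrable setT (EFin \o (f : Omega -> R))).
Local Notation E f := (Rintegral P setT f).
Local Notation past_type k := (g_sigma_algebraType (past w k)).

Lemma past_sub_measurable k : <<s past w k>> `<=` @measurable d Omega.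
Proof.
apply: smallest_sub; first exact: sigma_algebra_measurable.
move=> A [j _ [B mB <-]]; exact: measurable_funP.
Qed.

Lemma past_nondecreasing j k : (j <= k)%N -> <<s past w j>> `<=` <<s past w k>>.
Proof.
move=> jk; apply: sub_sigma_algebra2 => A [i /= ij Ai]; exists i => //=.
exact: leq_trans ij jk.
Qed.

Lemma noise_past k : measurable_fun setT (w k : past_type k.+1 -> R).
Proof.
move=> _ B mB; apply: sub_sigma_algebra; exists k => //=.
by exists B.
Qed.

Lemma adaptedP (K : hilbertType R) k (q : Omega -> K) :
  adapted w k q <-> borel_fun (q : past_type k -> K).
Proof.
split=> mq.
- move=> O oO; rewrite -[X in measurable X]setTI; apply: mq => //.
  exact: sub_sigma_algebra.
- apply: (@measurability _ _ _ (g_sigma_algebraType (@open K)) _ _ (@open K)).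
    by [].
  move=> _ [B oB <-].
  by rewrite setTI; exact: mq.
Qed.

Lemma past_measurable_fun k (f : Omega -> R) :
  measurable_fun setT (f : past_type k -> R) -> measurable_fun setT f.
Proof. by move=> mf _ B mB; apply: (@past_sub_measurable k); exact: mf. Qed.

Lemma borel_fun_mono (K : topologicalType) j k (q : Omega -> K) : (j <= k)%N ->
  borel_fun (q : past_type j -> K) -> borel_fun (q : past_type k -> K).
Proof. by move=> jk mq O oO; apply: (past_nondecreasing jk); exact: mq. Qed.

Variable N : nat.
Hypothesis w_cond : conditionally_orthonormal w N.

Lemma noise_sqr_int k : (k <= N)%N -> integ (fun t => w k t ^+ 2).
Proof.
move=> kN; apply: int_ge0P => [|t|]; last 2 first.
- exact: sqr_ge0.
- have [_ ->] := w_cond kN (@measurableT _ (past_type k)).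
  by rewrite [P _]probability_setT ltry.
- exact: measurable_funX.
Qed.

Lemma noise_int k : (k <= N)%N -> integ (w k).
Proof.
move=> kN; apply: int_le (intD (int_cst P 1) (noise_sqr_int kN)) _ => //.
move=> t; rewrite -[w k t ^+ 2]real_normK ?num_real//.
have := sqr_ge0 `|w k t|.
by have := sqr_ge0 (`|w k t| - 1); rewrite sqrrB1; lra.
Qed.

Let id_past k : measurable_fun setT (id : Omega -> past_type k).
Proof. by move=> _ B mB; rewrite setTI; exact: (@past_sub_measurable k B mB). Qed.

Lemma noise_sqr_event k F : (k <= N)%N -> <<s past w k>> F ->
  (\int[P]_(t in F) (w k t ^+ 2)%:E = \int[P]_(t in F) (1 : R)%:E)%E.
Proof.
move=> kN mF; have [_ ->] := w_cond kN mF.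
by rewrite integral_cst ?mul1e//; exact: (past_sub_measurable mF).
Qed.

Lemma noise_shift_sqr_event k F : (k <= N)%N -> <<s past w k>> F ->
  (\int[P]_(t in F) ((1 + w k t) ^+ 2)%:E = \int[P]_(t in F) (2 : R)%:E)%E.
Proof.
move=> kN mF; have [w1 w2] := w_cond kN mF.
have mF' : measurable F by exact: (past_sub_measurable mF).
have iF f : integ f -> P.-integrable F (EFin \o f).
  by move=> fi; apply: integrableS fi.
transitivity (\int[P]_(t in F) ((1 : R)%:E + (2%:E * (w k t)%:E + (w k t ^+ 2)%:E)))%E.
  by apply: eq_integral => t _; rewrite -EFinM -!EFinD; congr EFin; ring.
rewrite integralD//; last 2 first.
- exact: (iF _ (int_cst P 1)).
- exact: (iF _ (intD (intZ 2 (noise_int kN)) (noise_sqr_int kN))).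
rewrite integralD//; last 2 first.
- exact: (iF _ (intZ 2 (noise_int kN))).
- exact: (iF _ (noise_sqr_int kN)).
rewrite integralZl//; last exact: (iF _ (noise_int kN)).
rewrite w1 w2 mule0 add0e !integral_cst// mul1e.
by rewrite [in RHS](mule_natl _ 2) mule2n.
Qed.

(** The first-order term comes from [2 w = (1 + w) ^ 2 - 1 - w ^ 2], which
    keeps all the weights nonnegative. *)
Let noise_moments_ge0 k (f : Omega -> R) : (k <= N)%N ->
  measurable_fun setT (f : past_type k -> R) -> integ f -> (forall t, 0 <= f t) ->
  [/\ integ (fun t => f t * w k t), integ (fun t => f t * w k t ^+ 2),
      E (fun t => f t * w k t) = 0 & E (fun t => f t * w k t ^+ 2) = E f].
Proof.
move=> kN mf fi f0; have mf' := past_measurable_fun mf.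
have e1 : (\int[P]_t (f t * w k t ^+ 2)%:E = \int[P]_t (f t * 1)%:E)%E.
  apply: (eq_integral_weight (@id_past k)) mf f0 => //.
  - exact: measurable_funX.
  - by move=> t; exact: sqr_ge0.
  - by move=> F mF; exact: noise_sqr_event.
have e2 : (\int[P]_t (f t * (1 + w k t) ^+ 2)%:E = \int[P]_t (f t * 2)%:E)%E.
  apply: (eq_integral_weight (@id_past k)) mf f0 => //.
  - by apply: measurable_funX; exact: measurable_funD.
  - by move=> t; exact: sqr_ge0.
  - by move=> F mF; exact: noise_shift_sqr_event.
have E1 : (\int[P]_t (f t * 1)%:E = (E f)%:E)%E.
  by under eq_integral do rewrite mulr1; exact: integral_EFin.
have E2 : (\int[P]_t (f t * 2)%:E = (2 * E f)%:E)%E.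
  by under eq_integral do rewrite mulrC; rewrite integral_EFin ?EZ//; exact: intZ.
have i1 : integ (fun t => f t * w k t ^+ 2).
  apply: int_ge0P; [|by move=> t; rewrite mulr_ge0// sqr_ge0|by rewrite e1 E1 ltry].
  by apply: measurable_funM => //; exact: measurable_funX.
have i2 : integ (fun t => f t * (1 + w k t) ^+ 2).
  apply: int_ge0P; [|by move=> t; rewrite mulr_ge0// sqr_ge0|by rewrite e2 E2 ltry].
  by apply: measurable_funM => //; apply: measurable_funX; exact: measurable_funD.
have F1 : E (fun t => f t * w k t ^+ 2) = E f.
  by move: e1; rewrite E1 (integral_EFin i1) => -[].
have F2 : E (fun t => f t * (1 + w k t) ^+ 2) = 2 * E f.
  by move: e2; rewrite E2 (integral_EFin i2) => -[].
have wE : (fun t => f t * w k t) =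
    (fun t => 2^-1 * (f t * (1 + w k t) ^+ 2 - f t - f t * w k t ^+ 2)).
  by apply/funext => t; field.
have i3 := intB (intB i2 fi) i1.
split=> //; rewrite wE; first exact: intZ.
rewrite EZ// EB//; last exact: intB.
by rewrite EB// F1 F2; lra.
Qed.

(** [`|f| - (`|f| - f)] splits an integrable function into nonnegative
    integrable parts. *)
Lemma noise_moments k (f : Omega -> R) : (k <= N)%N ->
  measurable_fun setT (f : past_type k -> R) -> integ f ->
  [/\ integ (fun t => f t * w k t), integ (fun t => f t * w k t ^+ 2),
      E (fun t => f t * w k t) = 0 & E (fun t => f t * w k t ^+ 2) = E f].
Proof.
move=> kN mf fi.
have mn : measurable_fun setT (fun t : past_type k => `|f t|).
  exact: measurableT_comp.
have ni : integ (fun t => `|f t|) by exact: int_norm.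
have [a1 a2 a3 a4] := noise_moments_ge0 kN mn ni (fun t => normr_ge0 (f t)).
have [|t|b1 b2 b3 b4] := noise_moments_ge0 kN _ (intB ni fi).
- exact: measurable_funB.
- by rewrite subr_ge0 ler_norm.
have fE : f = (fun t => `|f t| - (`|f t| - f t)).
  by apply/funext => t; rewrite opprB addrC addrNK.
have wE n : (fun t => f t * w k t ^+ n) = (fun t =>
    `|f t| * w k t ^+ n - (`|f t| - f t) * w k t ^+ n).
  by apply/funext => t; rewrite -mulrBl opprB addrC addrNK.
have := wE 1%N; rewrite /= => w1.
rewrite w1 wE; split; [exact: intB|exact: intB| |].
- by rewrite EB// a3 b3 subr0.
- by rewrite EB// a4 b4 EB// opprB addrC addrNK.
Qed.

End Noise.

(** * Square integrable processes *)

Section SquareIntegrable.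
Context {R : realType} {d : measure_display} {Omega : measurableType d}.
Variables (P : probability Omega R) (w : nat -> {RV P >-> R}).

Local Notation integ f := (P.-integrable setT (EFin \o (f : Omega -> R))).
Local Notation E f := (Rintegral P setT f).
Local Notation past_type k := (g_sigma_algebraType (past w k)).

Definition sqint {K : hilbertType R} (k : nat) (q : Omega -> K) :=
  borel_fun (q : past_type k -> K) /\ integ (fun t => `|q t| ^+ 2).

Definition energy {K : hilbertType R} (q : Omega -> K) : R :=
  E (fun t => `|q t| ^+ 2).

Lemma energy_ge0 (K : hilbertType R) (q : Omega -> K) : 0 <= energy q.
Proof. by apply: E_ge0 => t; exact: sqr_ge0. Qed.

Lemma past_measurable_norm_sqr (K : hilbertType R) k (q : Omega -> K) :
  borel_fun (q : past_type k -> K) ->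
  measurable_fun setT (fun t : past_type k => `|q t| ^+ 2).
Proof.
move=> mq; apply: measurable_funX; apply/borel_fun_real.
by apply: (borel_fun_comp _ mq) => x; exact: norm_continuous.
Qed.

Lemma sqint_cst (K : hilbertType R) k (c : K) : sqint k (cst c).
Proof. by split; [exact: borel_fun_cst|exact: (int_cst P (`|c| ^+ 2))]. Qed.

Lemma sqint_mono (K : hilbertType R) j k (q : Omega -> K) : (j <= k)%N ->
  sqint j q -> sqint k q.
Proof. by move=> jk [mq iq]; split => //; exact: borel_fun_mono mq. Qed.

Lemma sqint_op (K L : hilbertType R) k (T : K -> L) (q : Omega -> K) :
  bounded_op T -> sqint k q -> sqint k (fun t => T (q t)).
Proof.
move=> bT [mq iq]; have mTq := borel_fun_comp (bop_continuous bT) mq.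
split => //; have [M M0 HM] := bop_bound bT.
apply: int_le (intZ (M ^+ 2) iq) _.
  exact: past_measurable_fun (past_measurable_norm_sqr mTq).
move=> t; rewrite ger0_norm ?sqr_ge0// -exprMn.
by rewrite ler_pXn2r ?nnegrE ?mulr_ge0// ltW.
Qed.

Lemma energy_op (K L : hilbertType R) k (T : K -> L) M (q : Omega -> K) :
  bounded_op T -> sqint k q -> 0 <= M -> (forall x, `|T x| <= M * `|x|) ->
  energy (fun t => T (q t)) <= M ^+ 2 * energy q.
Proof.
move=> bT qi M0 HM; have [_ iq] := qi; have [_ iTq] := sqint_op bT qi.
rewrite -EZ//; apply: E_le => //; first exact: intZ.
by move=> t; rewrite -exprMn ler_pXn2r ?nnegrE ?mulr_ge0.
Qed.

Section Separable.
Variables (K : hilbertType R).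
Hypothesis K_sep : separable K.

Lemma sqintD k (f g : Omega -> K) :
  sqint k f -> sqint k g -> sqint k (fun t => f t + g t).
Proof.
move=> [mf fi] [mg gi].
have mfg : borel_fun ((fun t => f t + g t) : past_type k -> K).
  by apply: (@borel_fun2 _ _ _ _ _ _ (fun p => p.1 + p.2)) => //; exact: add_continuous.
split => //; apply: int_le (intD (intZ 2 fi) (intZ 2 gi)) _.
  exact: past_measurable_fun (past_measurable_norm_sqr mfg).
by move=> t; rewrite ger0_norm ?sqr_ge0// normD_sqr_le.
Qed.

Lemma energyD k (f g : Omega -> K) : sqint k f -> sqint k g ->
  energy (fun t => f t + g t) <= 2 * energy f + 2 * energy g.
Proof.
move=> fi gi; have [_ i] := sqintD fi gi; case: fi gi => _ fi [_ gi].
rewrite -!EZ// -ED; [|exact: intZ..]; apply: E_le => //.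
  by apply: intD; exact: intZ.
by move=> t; exact: normD_sqr_le.
Qed.

Lemma energy_lincomb (K1 K2 : hilbertType R) (T : K1 -> K) (S : K2 -> K) :
  bounded_op T -> bounded_op S -> exists2 c : R, 0 <= c &
  forall k f g, sqint k f -> sqint k g ->
    energy (fun t => T (f t) + S (g t)) <= c * (energy f + energy g).
Proof.
move=> bT bS; have [M M0 HM] := bop_bound bT; have [L L0 HL] := bop_bound bS.
have M2 := sqr_ge0 M; have L2 := sqr_ge0 L.
exists (2 * (M ^+ 2 + L ^+ 2)) => [|k f g fi gi]; first by lra.
apply: le_trans (energyD (sqint_op bT fi) (sqint_op bS gi)) _.
have e1 := energy_op bT fi (ltW M0) HM; have e2 := energy_op bS gi (ltW L0) HL.
have e3 := mulr_ge0 M2 (energy_ge0 g); have e4 := mulr_ge0 L2 (energy_ge0 f).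
by rewrite -mulrA mulrDl !mulrDr; lra.
Qed.

(** Measurability comes from polarisation, integrability from
    Cauchy-Schwarz. *)
Lemma sqint_inner k (f g : Omega -> K) : sqint k f -> sqint k g ->
  measurable_fun setT (fun t : past_type k => ⟪f t, g t⟫) /\
  integ (fun t => ⟪f t, g t⟫).
Proof.
move=> fi gi.
have mD q : sqint k q -> measurable_fun setT (fun t : past_type k => `|q t| ^+ 2).
  by move=> [mq _]; exact: past_measurable_norm_sqr.
have m1 : measurable_fun setT (fun t : past_type k => ⟪f t, g t⟫).
  have -> : (fun t => ⟪f t, g t⟫) =
      (fun t => 2^-1 * (`|f t + g t| ^+ 2 - `|f t| ^+ 2 - `|g t| ^+ 2)).
    by apply/funext => t; rewrite normD_sqr; field.
  apply: measurable_funM; first exact: measurable_cst.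
  apply: measurable_funB; last exact: mD.
  by apply: measurable_funB; apply: mD => //; exact: sqintD.
split => //; case: fi gi => _ fi [_ gi].
apply: int_le (intD fi gi) _; first exact: past_measurable_fun m1.
move=> t; apply: le_trans (CauchySchwarz _ _) _.
have := sqr_ge0 (`|f t| - `|g t|); rewrite sqrrB.
have := mulr_ge0 (normr_ge0 (f t)) (normr_ge0 (g t)); lra.
Qed.

Variable N : nat.
Hypothesis w_cond : conditionally_orthonormal w N.

Lemma sqint_noise k (g : Omega -> K) : (k <= N)%N -> sqint k g ->
  sqint k.+1 (fun t => w k t *: g t).
Proof.
move=> kN [mg gi].
have mw : borel_fun ((fun t => w k t *: g t) : past_type k.+1 -> K).
  apply: (@borel_fun2 _ _ _ R _ _ (fun p : R * K => p.1 *: p.2)) => //.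
  - exact: separable_real.
  - exact: scale_continuous.
  - by apply/borel_fun_real; exact: noise_past.
  - exact: borel_fun_mono mg.
split => //.
have [_ i _ _] := noise_moments w_cond kN (past_measurable_norm_sqr mg) gi.
apply: int_le i _.
  exact: past_measurable_fun (past_measurable_norm_sqr mw).
move=> t; rewrite ger0_norm ?sqr_ge0// normrZ exprMn mulrC.
by rewrite [`|w k t| ^+ 2]real_normK ?num_real.
Qed.

(** The noise at time [k] is orthogonal to the past, so the cross term of the
    quadratic form has mean zero and the noise has unit weight. *)
Lemma quadratic_noise k (Y : K -> K) (a b : Omega -> K) : (k <= N)%N ->
  selfadjoint Y -> sqint k a -> sqint k b ->
  E (fun t => ⟪Y (a t + w k t *: b t), a t + w k t *: b t⟫) =
  E (fun t => ⟪Y (a t), a t⟫ + ⟪Y (b t), b t⟫).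
Proof.
move=> kN /selfadjointP[bY sY] ai bi.
have [_ iaa] := sqint_inner (sqint_op bY ai) ai.
have [mab iab] := sqint_inner (sqint_op bY ai) bi.
have [mbb ibb] := sqint_inner (sqint_op bY bi) bi.
have [j1 _ e1 _] := noise_moments w_cond kN mab iab.
have [_ j2 _ e2] := noise_moments w_cond kN mbb ibb.
have -> : (fun t => ⟪Y (a t + w k t *: b t), a t + w k t *: b t⟫) =
    (fun t => ⟪Y (a t), a t⟫ + 2 * (⟪Y (a t), b t⟫ * w k t)
              + ⟪Y (b t), b t⟫ * w k t ^+ 2).
  apply/funext => t; rewrite (bopD bY) (bopZ bY) !innerE (sY (b t) (a t)).
  by rewrite (innerC (b t) (Y (a t))); ring.
have k1 := intZ 2 j1.
rewrite ED//; last exact: intD.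
by rewrite ED// EZ// e1 e2 mulr0 addr0 -ED.
Qed.

Lemma energy_noise k (a b : Omega -> K) : (k <= N)%N -> sqint k a -> sqint k b ->
  energy (fun t => a t + w k t *: b t) = energy a + energy b.
Proof.
move=> kN ai bi; have [_ iA] := ai; have [_ iB] := bi; rewrite /energy -ED//.
have sI : selfadjoint (id : K -> K).
  by apply/selfadjointP; split => //; exact: bounded_op_id.
have := quadratic_noise kN sI ai bi.
under eq_Rintegral do rewrite inner_normE.
by under [in RHS]eq_Rintegral do rewrite !inner_normE.
Qed.

End Separable.

Lemma L2normE (K : hilbertType R) N (q : nat -> Omega -> K) :
  (forall k, (k <= N)%N -> sqint k (q k)) ->
  L2norm P N q = (Num.sqrt (\sum_(k < N.+1) energy (q k)))%:E.
Proof.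
move=> qi; rewrite /L2norm.
under eq_bigr => k _.
  rewrite unlock (integral_EFin (f := fun t => `|q k t| ^+ 2)); last first.
    by have [_ ik] := qi k (ltn_ord k).
  over.
by rewrite sumEFin.
Qed.

Lemma L2P (K : hilbertType R) N (q : nat -> Omega -> K) :
  L2 w N q <-> forall k, (k <= N)%N -> sqint k (q k).
Proof.
split=> [[aq fq] k kN|qi]; last first.
  split; last by rewrite L2normE// ltry.
  by move=> k /qi[mq _]; exact/adaptedP.
have /adaptedP mq := aq k kN; split=> //.
apply: int_ge0P => [|t|]; last 2 first.
- exact: sqr_ge0.
- have : (\sum_(j < N.+1) 'E_P[fun t => (`|q j t| ^+ 2)%R] < +oo)%E.
    by move: fq; rewrite /L2norm; case: (\sum_(_ < _) _)%R => [r| |] //= _; rewrite ltry.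
  apply: le_lt_trans; rewrite (bigD1 (Ordinal (kN : (k < N.+1)%N)))//=.
  have -> : ('E_P[fun t => (`|q k t| ^+ 2)%R] = \int[P]_t (`|q k t| ^+ 2)%:E)%E.
    by rewrite unlock.
  rewrite leeDl//.
  by apply: sume_ge0 => i _; apply: expectation_ge0 => t; exact: sqr_ge0.
- exact: past_measurable_fun (past_measurable_norm_sqr mq).
Qed.

End SquareIntegrable.

(** * One step of the Riccati equation *)

Section RiccatiStep.
Context {R : realType} {H V Z : hilbertType R}.
Variables (A C : nat -> H -> H) (B1 D1 : nat -> V -> H).
Variables (Cb : nat -> H -> Z) (Db : nat -> V -> Z) (gamma : R) (k : nat).
Hypotheses (bA : bounded_op (A k)) (bC : bounded_op (C k)).
Hypotheses (bB : bounded_op (B1 k)) (bD : bounded_op (D1 k)).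
Hypotheses (bCb : bounded_op (Cb k)) (bDb : bounded_op (Db k)).
Hypothesis Db_Cb : (Db k)^† \o Cb k = 0.
Variable X : H -> H.
Hypothesis sX : selfadjoint X.

Let bX : bounded_op X. Proof. by have [] := sX. Qed.

Local Notation p1 := (pi1 A C Cb X k).
Local Notation p2 := (pi2 A C B1 D1 X k).
Local Notation p3 := (pi3 B1 D1 Db gamma X k).

(** Up to sign, the minimising feedback when [X] measures the cost of the next
    state and [pi3] is positive. *)
Definition gain : H -> V := op_inv p3 \o p2.

Definition riccati : H -> H := p1 - (p2^† \o op_inv p3 \o p2).

Let symX x y : ⟪X x, y⟫ = ⟪x, X y⟫.
Proof. by have /selfadjointP[_ ->] := sX. Qed.

Let adjl (K L : hilbertType R) (T : K -> L) (bT : bounded_op T) x y :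
  ⟪T^† y, x⟫ = ⟪y, T x⟫.
Proof. by rewrite innerC -adjointP// innerC. Qed.

Lemma pi1_form x y :
  ⟪p1 x, y⟫ = ⟪X (A k x), A k y⟫ + ⟪X (C k x), C k y⟫ - ⟪Cb k x, Cb k y⟫.
Proof. by rewrite /pi1 !addrfctE !opprfctE !innerE /= !adjl. Qed.

Lemma pi2_form x v : ⟪p2 x, v⟫ = ⟪X (A k x), B1 k v⟫ + ⟪X (C k x), D1 k v⟫.
Proof. by rewrite /pi2 !addrfctE !innerE /= !adjl. Qed.

Lemma pi3_form u v : ⟪p3 u, v⟫ = gamma ^+ 2 * ⟪u, v⟫ - ⟪Db k u, Db k v⟫
  + ⟪X (B1 k u), B1 k v⟫ + ⟪X (D1 k u), D1 k v⟫.
Proof.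
by rewrite /pi3 !addrfctE !opprfctE !scalrfctE !innerE /= !adjl.
Qed.

Lemma bounded_op_pi2 : bounded_op p2.
Proof.
by apply: bounded_opD; apply: bounded_op_comp => //; apply: bounded_op_comp => //;
  exact: bounded_op_adjoint.
Qed.

Lemma selfadjoint_pi1 : selfadjoint p1.
Proof.
apply/selfadjointP; split.
  apply: bounded_opD; last apply: bounded_opN; first apply: bounded_opD;
    apply: bounded_op_comp => //; try apply: bounded_op_comp => //;
    exact: bounded_op_adjoint.
move=> x y; rewrite pi1_form [RHS]innerC pi1_form.
by rewrite (symX (A k y)) (symX (C k y)) (innerC (A k y)) (innerC (C k y))
  (innerC (Cb k y)).
Qed.

Lemma selfadjoint_pi3 : selfadjoint p3.
Proof.
apply/selfadjointP; split.
  apply: bounded_opD; first (apply: bounded_opD; first apply: bounded_opD).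
  - by apply: bounded_opZ; exact: bounded_op_id.
  - by apply/bounded_opN/bounded_op_comp => //; exact: bounded_op_adjoint.
  - by apply: bounded_op_comp => //; apply: bounded_op_comp => //;
      exact: bounded_op_adjoint.
  - by apply: bounded_op_comp => //; apply: bounded_op_comp => //;
      exact: bounded_op_adjoint.
move=> x y; rewrite pi3_form [RHS]innerC pi3_form.
by rewrite (symX (B1 k y)) (symX (D1 k y)) (innerC (B1 k y)) (innerC (D1 k y))
  (innerC (Db k y)) (innerC y).
Qed.

Lemma stage_form x v :
  gamma ^+ 2 * `|v| ^+ 2 - `|Cb k x + Db k v| ^+ 2
  + (⟪X (A k x + B1 k v), A k x + B1 k v⟫
     + ⟪X (C k x + D1 k v), C k x + D1 k v⟫) =
  ⟪p3 v, v⟫ + 2 * ⟪p2 x, v⟫ + ⟪p1 x, x⟫.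
Proof.
have cross : ⟪Cb k x, Db k v⟫ = 0.
  have /(congr1 (fun T => T x)) /= := Db_Cb => h.
  by rewrite -(adjl bDb) h; exact: inner0l.
rewrite normD_sqr cross pi1_form pi2_form pi3_form !(bopD bX) !innerE.
rewrite (symX (B1 k v) (A k x)) (symX (D1 k v) (C k x)).
rewrite (innerC (B1 k v)) (innerC (D1 k v)) -!inner_normE; ring.
Qed.

Hypothesis p3_gt0 : op_gt0 p3.

Let bp2 := bounded_op_pi2.

Lemma bounded_op_gain : bounded_op gain.
Proof. by apply: bounded_op_comp => //; have [] := op_inv_selfadjoint p3_gt0. Qed.

Lemma riccati_form x y : ⟪riccati x, y⟫ = ⟪p1 x, y⟫ - ⟪gain x, p2 y⟫.
Proof.
rewrite /riccati addrfctE opprfctE innerDl innerNl; congr (_ - _).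
exact: (adjl bp2).
Qed.

Lemma selfadjoint_riccati : selfadjoint riccati.
Proof.
have [b1 _] := selfadjoint_pi1; have bg := bounded_op_gain.
apply/selfadjointP; split.
  by apply: bounded_opD => //;
    apply/bounded_opN/(@bounded_op_comp _ _ _ _ p2^† gain) => //;
    exact: bounded_op_adjoint.
move=> x y; rewrite riccati_form [RHS]innerC riccati_form.
have /selfadjointP[_ ->] := selfadjoint_pi1; rewrite (innerC x); congr (_ - _).
have /selfadjointP[_ si] := op_inv_selfadjoint p3_gt0.
by rewrite /gain /= si innerC.
Qed.

(** Completing the square in the disturbance: the minimum over [v] of the stage
    cost plus the cost to go is the Riccati form, attained at [- gain x]. *)
Lemma complete_square x v :
  gamma ^+ 2 * `|v| ^+ 2 - `|Cb k x + Db k v| ^+ 2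
  + (⟪X (A k x + B1 k v), A k x + B1 k v⟫
     + ⟪X (C k x + D1 k v), C k x + D1 k v⟫) =
  ⟪riccati x, x⟫ + ⟪p3 (v + gain x), v + gain x⟫.
Proof.
have /selfadjointP[b3 s3] := selfadjoint_pi3.
have p3g : p3 (gain x) = p2 x by rewrite /gain /= op_invK.
rewrite stage_form riccati_form (bopD b3) (innerDl (p3 v)) !(innerDr v).
rewrite (s3 v (gain x)) p3g (innerC v (p2 x)) (innerC (gain x)); ring.
Qed.

End RiccatiStep.

(** * The cost of a disturbance *)

(** [y] is a storage function vanishing at both ends; [c] is what remains of the
    stage costs. *)
Lemma telescope_cost (R : realType) (n : nat) (e y c : nat -> R) :
  y 0 = 0 -> y n = 0 -> (forall k, (k < n)%N -> e k = y k - y k.+1 + c k) ->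
  \sum_(k < n) e k = \sum_(k < n) c k.
Proof.
move=> y0 yn ek; rewrite (eq_bigr (fun k : 'I_n => y k - y k.+1 + c k)); last first.
  by move=> k _; exact: ek.
rewrite big_split /= -[RHS]add0r; congr (_ + _).
rewrite -(big_mkord xpredT (fun k => y k - y k.+1)).
under eq_bigr do rewrite -opprB.
by rewrite sumrN telescope_sumr// y0 yn subrr oppr0.
Qed.

Section BoundedReal.
Context {R : realType} {H V Z : hilbertType R}.
Hypotheses (H_sep : separable H) (V_sep : separable V) (Z_sep : separable Z).
Context {d : measure_display} {Omega : measurableType d}.
Variables (P : probability Omega R) (N : nat) (w : nat -> {RV P >-> R}).
Hypothesis w_cond : conditionally_orthonormal w N.
Variables (A C : nat -> H -> H) (B1 D1 : nat -> V -> H).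
Variables (Cb : nat -> H -> Z) (Db : nat -> V -> Z).
Hypotheses (A_bd : forall k, (k <= N)%N -> bounded_op (A k))
  (C_bd : forall k, (k <= N)%N -> bounded_op (C k))
  (B1_bd : forall k, (k <= N)%N -> bounded_op (B1 k))
  (D1_bd : forall k, (k <= N)%N -> bounded_op (D1 k))
  (Cb_bd : forall k, (k <= N)%N -> bounded_op (Cb k))
  (Db_bd : forall k, (k <= N)%N -> bounded_op (Db k))
  (Db_Cb : forall k, (k <= N)%N -> (Db k)^† \o Cb k = 0).
Variables (gamma : R) (gamma_gt0 : 0 < gamma).

Local Notation E f := (Rintegral P setT f).
Local Notation x := (state w A C B1 D1 0).
Local Notation z := (perturbation w A C B1 D1 Cb Db).
Local Notation p1 k X := (pi1 A C Cb X k).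
Local Notation p2 k X := (pi2 A C B1 D1 X k).
Local Notation p3 k X := (pi3 B1 D1 Db gamma X k).
Local Notation gn k X := (gain A C B1 D1 Db gamma k X).
Local Notation ric k X := (riccati A C B1 D1 Cb Db gamma k X).
Local Notation disturbance v :=
  (forall k, (k <= N)%N -> sqint w k ((v : nat -> Omega -> V) k)).

Definition cost (v : nat -> Omega -> V) (k : nat) : R :=
  gamma ^+ 2 * energy P (v k) - energy P (z v k).

Lemma sqint_drift v k : (k <= N)%N -> sqint w k (x v k) -> sqint w k (v k) ->
  sqint w k (fun t => A k (x v k t) + B1 k (v k t)) /\
  sqint w k (fun t => C k (x v k t) + D1 k (v k t)).
Proof.
move=> kN xi vi; split; apply: sqintD => //.
- exact: sqint_op (A_bd kN) xi.
- exact: sqint_op (B1_bd kN) vi.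
- exact: sqint_op (C_bd kN) xi.
- exact: sqint_op (D1_bd kN) vi.
Qed.

Lemma sqint_stateS v k : (k <= N)%N -> sqint w k (x v k) -> sqint w k (v k) ->
  sqint w k.+1 (x v k.+1).
Proof.
move=> kN xi vi; have [a b] := sqint_drift kN xi vi.
apply: sqintD => //; first exact: sqint_mono a.
exact: sqint_noise w_cond _ _ kN b.
Qed.

Lemma sqint_state v : disturbance v ->
  forall k, (k <= N.+1)%N -> sqint w k (x v k).
Proof.
move=> vi; elim=> [_|k IH kN]; first exact: sqint_cst.
exact: sqint_stateS (IH (leqW kN)) (vi k kN).
Qed.

Lemma sqint_perturbation v : disturbance v ->
  forall k, (k <= N)%N -> sqint w k (z v k).
Proof.
move=> vi k kN; apply: sqintD => //.
- exact: sqint_op (Cb_bd kN) (sqint_state vi (leqW kN)).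
- exact: sqint_op (Db_bd kN) (vi k kN).
Qed.

(** The noise is integrated out, so that one stage of the cost becomes the mean
    of a quadratic form in the present state and disturbance only. *)
Lemma stage_cost v k (Y : H -> H) : disturbance v -> (k <= N)%N ->
  selfadjoint Y ->
  cost v k + E (fun t => ⟪Y (x v k.+1 t), x v k.+1 t⟫) =
  E (fun t => gamma ^+ 2 * `|v k t| ^+ 2
     - `|Cb k (x v k t) + Db k (v k t)| ^+ 2
     + (⟪Y (A k (x v k t) + B1 k (v k t)), A k (x v k t) + B1 k (v k t)⟫
        + ⟪Y (C k (x v k t) + D1 k (v k t)), C k (x v k t) + D1 k (v k t)⟫)).
Proof.
move=> vi kN sY; have [bY _] := sY.
have [ai bi] := sqint_drift kN (sqint_state vi (leqW kN)) (vi k kN).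
have [_ iz] := sqint_perturbation vi kN; have [_ iv] := vi k kN.
have [_ iYa] := sqint_inner H_sep (sqint_op bY ai) ai.
have [_ iYb] := sqint_inner H_sep (sqint_op bY bi) bi.
rewrite /cost /energy (quadratic_noise H_sep w_cond kN sY ai bi).
have iv' := intZ (gamma ^+ 2) iv.
rewrite [RHS]ED; [|exact: intB|exact: intD].
by rewrite EB// EZ.
Qed.

(** * From the Riccati equation to the norm bound *)

Section Sufficiency.
Variable Y : nat -> H -> H.
Hypothesis Y_sa : forall k, (k <= N.+1)%N -> selfadjoint (Y k).
Hypothesis Y_end : Y N.+1 = 0.
Hypothesis Y_ric : forall k, (k <= N)%N -> Y k = ric k (Y k.+1).
Hypothesis Y_pos : forall k, (k <= N)%N -> op_gt0 (p3 k (Y k.+1)).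

Let u v k t := v k t + gn k (Y k.+1) (x v k t).
Let slack v k := E (fun t => ⟪p3 k (Y k.+1) (u v k t), u v k t⟫).
Let total v := \sum_(k < N.+1) slack v k.

Let bg k : (k <= N)%N -> bounded_op (gn k (Y k.+1)).
Proof.
move=> kN; apply: bounded_op_gain => //; [exact: A_bd|exact: C_bd|exact: B1_bd|
  exact: D1_bd|exact: Y_sa|exact: Y_pos].
Qed.

Let ui v k : disturbance v -> (k <= N)%N -> sqint w k (u v k).
Proof.
move=> vi kN; apply: sqintD => //; first exact: vi.
exact: sqint_op (bg kN) (sqint_state vi (leqW kN)).
Qed.

(** Completing the square at every stage makes the values [⟪Y k x, x⟫] telescope;
    they vanish at both ends as [x 0 = 0] and [Y N.+1 = 0]. *)
Lemma cost_slack v : disturbance v -> \sum_(k < N.+1) cost v k = total v.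
Proof.
move=> vi; pose y k := E (fun t => ⟪Y k (x v k t), x v k t⟫).
apply: (@telescope_cost _ _ _ y).
- rewrite /y -[RHS](E_cst P); apply: eq_Rintegral => t _ /=.
  exact: inner0r.
- rewrite /y -[RHS](E_cst P); apply: eq_Rintegral => t _ /=.
  by rewrite Y_end; exact: inner0l.
move=> k kN; have := stage_cost vi kN (Y_sa (kN : (k.+1 <= N.+1)%N)).
under [in RHS]eq_Rintegral => t _.
  rewrite complete_square; [|exact: A_bd|exact: C_bd|exact: B1_bd|exact: D1_bd|
    exact: Cb_bd|exact: Db_bd|exact: Db_Cb|exact: Y_sa|exact: Y_pos].
  rewrite -Y_ric//; over.
have xi := sqint_state vi (leqW kN).
have [bY _] := Y_sa (leqW kN); have [b3 _] := op_gt0_selfadjoint (Y_pos kN).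
have [_ i1] := sqint_inner H_sep (sqint_op bY xi) xi.
have [_ i2] := sqint_inner V_sep (sqint_op b3 (ui vi kN)) (ui vi kN).
rewrite ED// -/(y k) -/(y k.+1) -/(slack v k) => h.
by rewrite addrAC -h addrK.
Qed.

Let slack_bound k : (k <= N)%N -> exists2 c : R, 0 < c &
  forall v, disturbance v -> energy P (u v k) <= c * slack v k.
Proof.
move=> kN; have [th th0 coer] := op_gt0P (Y_pos kN).
exists th^-1; first by rewrite invr_gt0.
move=> v vi; rewrite mulrC ler_pdivlMr// mulrC.
have [b3 _] := op_gt0_selfadjoint (Y_pos kN).
have [_ iu] := ui vi kN.
have [_ i2] := sqint_inner V_sep (sqint_op b3 (ui vi kN)) (ui vi kN).
by rewrite /energy -EZ//; apply: E_le => //; exact: intZ.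
Qed.

Let slack_ge0 v k : disturbance v -> (k <= N)%N -> 0 <= slack v k.
Proof.
move=> vi kN; have [c c0 /(_ v vi) h] := slack_bound kN.
by rewrite -(pmulr_rge0 _ c0) (le_trans _ h)// energy_ge0.
Qed.

Let total_ge0 v : disturbance v -> 0 <= total v.
Proof.
by move=> vi; apply: sumr_ge0 => k _; apply: slack_ge0 => //; exact: ltn_ord k.
Qed.

Let slack_le_total v k : disturbance v -> (k <= N)%N -> slack v k <= total v.
Proof.
move=> vi kN; rewrite /total (bigD1 (Ordinal (kN : (k < N.+1)%N)))//= lerDl.
by apply: sumr_ge0 => i _; apply: slack_ge0 => //; exact: ltn_ord i.
Qed.

(** The map from [v] to [u = v + gain x] has a bounded causal inverse: the
    state energy, hence that of [v = u - gain x], is controlled stage by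
    stage by the energy of [u]. *)
Let disturbance_bound k : (k <= N)%N ->
  (exists2 a : R, 0 <= a & forall v, disturbance v -> energy P (x v k) <= a * total v) ->
  exists2 b : R, 0 <= b & forall v, disturbance v -> energy P (v k) <= b * total v.
Proof.
move=> kN [a a0 xb]; have [c c0 hc] := slack_bound kN.
have [e e0 he] := energy_lincomb w V_sep (bounded_op_id V) (bounded_opN (bg kN)).
exists (e * (c + a)) => [|v vi]; first by rewrite mulr_ge0// addr_ge0// ltW.
have -> : v k = (fun t => id (u v k t) + (- gn k (Y k.+1)) (x v k t)).
  by apply/funext => t; rewrite /u opprfctE addrK.
apply: le_trans (he _ _ _ (ui vi kN) (sqint_state vi (leqW kN))) _.
rewrite -mulrA ler_wpM2l// mulrDl lerD ?xb// (le_trans (hc v vi))//.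
by rewrite ler_pM2l// slack_le_total.
Qed.

Let state_bound k : (k <= N.+1)%N ->
  exists2 a : R, 0 <= a & forall v, disturbance v -> energy P (x v k) <= a * total v.
Proof.
elim: k => [_|k IH kN].
  exists 0 => // v vi; rewrite mul0r /energy.
  rewrite -[leRHS](E_cst P) le_eqVlt; apply/orP; left; apply/eqP.
  by apply: eq_Rintegral => t _ /=; rewrite normr0 expr0n.
have [a a0 xb] := IH (leqW kN).
have [|b b0 vb] := @disturbance_bound k kN; first by exists a.
have [c c0 hc] := energy_lincomb w H_sep (A_bd kN) (B1_bd kN).
have [e e0 he] := energy_lincomb w H_sep (C_bd kN) (D1_bd kN).
exists ((c + e) * (a + b)) => [|v vi]; first by rewrite mulr_ge0// addr_ge0.
have xi := sqint_state vi (leqW kN).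
have [ai bi] := sqint_drift kN xi (vi k kN).
rewrite [x v k.+1]/= (energy_noise H_sep w_cond kN ai bi) -mulrA mulrDl.
have ab : energy P (x v k) + energy P (v k) <= (a + b) * total v.
  by rewrite mulrDl lerD ?xb ?vb.
apply: lerD.
- by apply: le_trans (hc _ _ _ xi (vi k kN)) _; rewrite ler_wpM2l.
- by apply: le_trans (he _ _ _ xi (vi k kN)) _; rewrite ler_wpM2l.
Qed.

(** The bounded inverse turns nonnegativity of the slack into a uniform gap,
    which is what makes the norm strictly less than [gamma]. *)
Lemma cost_coercive : exists2 eps : R, 0 < eps & forall v, disturbance v ->
  eps * (\sum_(k < N.+1) energy P (v k)) <= \sum_(k < N.+1) cost v k.
Proof.
have sum_bound n : (n <= N.+1)%N -> exists2 b : R, 0 <= b & forall v, disturbance v ->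
    \sum_(k < n) energy P (v k) <= b * total v.
  elim: n => [_|n IH nN]; first by exists 0 => // v vi; rewrite big_ord0 mul0r.
  have [b b0 hb] := IH (ltnW nN).
  have [c c0 hc] := disturbance_bound nN (state_bound (leqW nN)).
  exists (b + c) => [|v vi]; first by rewrite addr_ge0.
  by rewrite big_ord_recr /= mulrDl lerD ?hb ?hc.
have [b b0 hb] := sum_bound N.+1 (leqnn _).
(* b may be 0 *)
exists (b + 1)^-1 => [|v vi]; first by rewrite invr_gt0 ltr_wpDl.
rewrite cost_slack// mulrC ler_pdivrMr ?ltr_wpDl// mulrC mulrDl mul1r.
by rewrite (le_trans (hb v vi))// lerDl total_ge0.
Qed.

End Sufficiency.

(** * From the norm bound to the Riccati equation *)

Section Necessity.

Fixpoint closed_loop (fb : nat -> H -> V) (k : nat) : Omega -> H :=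
  if k is j.+1 then fun t =>
    A j (closed_loop fb j t) + B1 j (fb j (closed_loop fb j t))
    + w j t *: (C j (closed_loop fb j t) + D1 j (fb j (closed_loop fb j t)))
  else fun=> 0.

Let feedback fb : nat -> Omega -> V := fun k t => fb k (closed_loop fb k t).

Lemma state_closed_loop fb k : x (feedback fb) k = closed_loop fb k.
Proof. by elim: k => //= k ->. Qed.

Lemma disturbance_feedback fb :
  (forall k q, (k <= N)%N -> sqint w k q -> sqint w k (fun t => fb k (q t))) ->
  disturbance (feedback fb).
Proof.
move=> hfb.
suff xi k : (k <= N.+1)%N -> sqint w k (closed_loop fb k).
  by move=> k kN; apply: hfb => //; apply: xi; exact: leqW.
elim: k => [_|k IH kN]; first exact: sqint_cst.
have ci := IH (leqW kN).
by rewrite -state_closed_loop; apply: sqint_stateS => //;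
  [rewrite state_closed_loop|exact: hfb].
Qed.

(** Iterate [i] is the solution at time [N.+1 - i]: counting stages from the
    horizon makes the backward recursion structural. *)
Fixpoint riccati_iter (i : nat) : H -> H :=
  if i is j.+1 then ric (N - j)%N (riccati_iter j) else 0.

Definition riccati_sol (k : nat) : H -> H := riccati_iter (N.+1 - k).
Local Notation Y := riccati_sol.

Lemma riccati_sol_end : Y N.+1 = 0.
Proof. by rewrite /riccati_sol subnn. Qed.

Lemma riccati_solE k : (k <= N)%N -> Y k = ric k (Y k.+1).
Proof. by move=> kN; rewrite /riccati_sol subSn//= subKn// subSS. Qed.

Let solvable_from m :=
  (forall k, (m <= k <= N.+1)%N -> selfadjoint (Y k)) /\
  (forall k, (m <= k <= N)%N -> op_gt0 (p3 k (Y k.+1))).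

(** The disturbance is silent before [m], a fixed vector at [m], and cancels the
    completed squares afterwards.  The state is then zero up to [m], so the only
    cost left is the quadratic form of [pi3] at stage [m]; this recovers the
    form from the input-output behaviour with zero initial state. *)
Lemma test_disturbance m u0 : (m <= N)%N -> solvable_from m.+1 ->
  exists v, [/\ disturbance v,
    \sum_(k < N.+1) cost v k = ⟪p3 m (Y m.+1) u0, u0⟫ &
    `|u0| ^+ 2 <= \sum_(k < N.+1) energy P (v k)].
Proof.
move=> mN [Ysa Ypos].
pose fb k y := if (k < m)%N then 0 else if k == m then u0
               else - gn k (Y k.+1) y.
have bg k : (m < k)%N -> (k <= N)%N -> bounded_op (gn k (Y k.+1)).
  move=> mk kN; apply: bounded_op_gain => //; [exact: A_bd|exact: C_bd|
    exact: B1_bd|exact: D1_bd|by apply: Ysa; rewrite ltnW|].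
  by apply: Ypos; rewrite mk.
have vi : disturbance (feedback fb).
  apply: disturbance_feedback => k q kN qi; rewrite /fb.
  case: ltngtP => mk; [exact: sqint_cst| |exact: sqint_cst].
  exact: sqint_op (bounded_opN (bg k mk kN)) qi.
set v := feedback fb in vi *.
have v0 k t : (k < m)%N -> v k t = 0 by move=> km; rewrite /v /feedback /fb km.
have vm t : v m t = u0 by rewrite /v /feedback /fb ltnn eqxx.
have vgt k t : (m < k)%N -> v k t = - gn k (Y k.+1) (x v k t).
  move=> mk; rewrite state_closed_loop /v /feedback /fb.
  by rewrite ltnNge (ltnW mk) /= gtn_eqF.
have x0 k : (k <= m)%N -> x v k = fun=> 0.
  elim: k => // k IH km; apply/funext => t /=.
  rewrite IH ?(ltnW km)// v0//; have kN : (k <= N)%N by apply: ltnW (leq_trans km mN).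
  rewrite (bop0 (A_bd kN)) (bop0 (B1_bd kN)) (bop0 (C_bd kN)) (bop0 (D1_bd kN)).
  by rewrite !addr0 scaler0 addr0.
exists v; split => //; last first.
  rewrite (bigD1 (Ordinal (mN : (m < N.+1)%N)))//= -[leLHS]addr0 lerD//.
  - rewrite /energy -[leLHS](E_cst P) le_eqVlt; apply/orP; left; apply/eqP.
    by apply: eq_Rintegral => t _; rewrite vm.
  - by apply: sumr_ge0 => k _; exact: energy_ge0.
(* below m the positivity of pi3 is unknown, but the state vanishes there *)
pose y k := if (k <= m)%N then 0 else E (fun t => ⟪Y k (x v k t), x v k t⟫).
pose c k := if k == m then ⟪p3 m (Y m.+1) u0, u0⟫ else 0.
transitivity (\sum_(k < N.+1) c k); last first.
  rewrite (bigD1 (Ordinal (mN : (m < N.+1)%N)))//= /c eqxx big1 ?addr0// => k.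
  by rewrite -val_eqE /= => /negPf ->.
apply: (@telescope_cost _ _ _ y) => [//||k kN].
  rewrite /y leqNgt ltnS mN /= riccati_sol_end -[RHS](E_cst P).
  by apply: eq_Rintegral => t _; exact: inner0l.
have bnd := (A_bd kN, C_bd kN, B1_bd kN, D1_bd kN, Cb_bd kN, Db_bd kN).
have [km|mk] := ltnP k m.
  rewrite /y /c km (ltnW km) (ltn_eqF km) subrr add0r /cost /energy.
  have e0 (K : hilbertType R) (q : Omega -> K) : (forall t, q t = 0) ->
      E (fun t => `|q t| ^+ 2) = 0.
    move=> q0; rewrite -[RHS](E_cst P); apply: eq_Rintegral => t _.
    by rewrite q0 normr0 expr0n.
  rewrite !e0 ?mulr0 ?subrr// => t; last exact: v0.
  rewrite /perturbation x0 ?(ltnW km)// v0//.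
  by rewrite (bop0 (Cb_bd kN)) (bop0 (Db_bd kN)) addr0.
have sY : selfadjoint (Y k.+1) by apply: Ysa; rewrite ltnS mk.
have := stage_cost vi kN sY.
move: mk; rewrite leq_eqVlt => /predU1P[mk|mk].
- subst k.
  under [in RHS]eq_Rintegral => t _.
    rewrite stage_form; [|exact: A_bd|exact: C_bd|exact: B1_bd|exact: D1_bd|
      exact: Cb_bd|exact: Db_bd|exact: Db_Cb|exact: sY].
    rewrite x0// vm.
    have bp2 := bounded_op_pi2 (A_bd mN) (C_bd mN) (B1_bd mN) (D1_bd mN) sY.
    rewrite (bop0 bp2) inner0l inner0r mulr0 !addr0; over.
  by rewrite E_cst /y /c eqxx leqnn ltnn => <-; rewrite sub0r addrC addrK.
- under [in RHS]eq_Rintegral => t _.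
    rewrite complete_square; [|exact: A_bd|exact: C_bd|exact: B1_bd|exact: D1_bd|
      exact: Cb_bd|exact: Db_bd|exact: Db_Cb|exact: sY|by apply: Ypos; rewrite mk].
    rewrite vgt// addNr inner0r addr0 -riccati_solE//; over.
  rewrite /y /c (gtn_eqF mk) addr0 (leqNgt k m) mk (ltnNge k m) (ltnW mk) /= => <-.
  by rewrite addrK.
Qed.

(** Backward induction: the gap [eps] of the cost is a lower bound for each
    [pi3], so the next Riccati step is well defined. *)
Lemma riccati_solvable eps : 0 < eps ->
  (forall v, disturbance v -> 0 < \sum_(k < N.+1) energy P (v k) ->
    eps * (\sum_(k < N.+1) energy P (v k)) <= \sum_(k < N.+1) cost v k) ->
  solvable_from 0.
Proof.
move=> eps0 coer.
suff h i : (i <= N.+1)%N -> solvable_from (N.+1 - i).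
  by have := h N.+1 (leqnn _); rewrite subnn.
elim: i => [_|i IH iN].
  rewrite subn0; split=> k /andP[h1 h2].
  - have -> : k = N.+1 by apply/eqP; rewrite eqn_leq h1 h2.
    rewrite riccati_sol_end; apply/selfadjointP; split; first exact: bounded_op0.
    by move=> a b; rewrite [LHS]inner0l; apply/esym; exact: inner0r.
  - by move: (leq_trans h1 h2); rewrite ltnn.
have := IH (ltnW iN); set m := (N.+1 - i.+1)%N.
have -> : (N.+1 - i)%N = m.+1 by rewrite /m subSS subSn.
have mN : (m <= N)%N by rewrite /m subSS leq_subr.
move=> good; have [Ysa Ypos] := good.
have sY : selfadjoint (Y m.+1) by apply: Ysa; rewrite leqnn.
have pos : op_gt0 (p3 m (Y m.+1)).
  apply: (op_gt0I eps0).
    apply: selfadjoint_pi3 => //; [exact: B1_bd|exact: D1_bd|exact: Db_bd].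
  move=> u0; have [->|u00] := eqVneq u0 0.
    by rewrite normr0 expr0n mulr0 inner0r.
  have [v [vi <- uv]] := test_disturbance u0 mN good.
  apply: le_trans (coer v vi _); first by rewrite ler_pM2l.
  by apply: lt_le_trans uv; rewrite exprn_gt0// normr_gt0.
split=> k /andP[]; rewrite leq_eqVlt => /predU1P[<-|mk] kN.
- rewrite riccati_solE//.
  by apply: selfadjoint_riccati => //; [exact: A_bd|exact: C_bd|exact: B1_bd|
    exact: D1_bd|exact: Cb_bd].
- by apply: Ysa; rewrite mk.
- by [].
- by apply: Ypos; rewrite mk.
Qed.

End Necessity.

(** * The norm and the cost *)

(** A norm strictly below [gamma] is a strictly positive gap [eps] between the
    squares, because a supremum below [gamma] stays away from it. *)
Lemma Hinf_norm_ltP :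
  (Hinf_norm w A C B1 D1 Cb Db N < gamma%:E)%E <->
  exists2 eps : R, 0 < eps & forall v, disturbance v ->
    0 < \sum_(k < N.+1) energy P (v k) ->
    eps * (\sum_(k < N.+1) energy P (v k)) <= \sum_(k < N.+1) cost v k.
Proof.
have costE v : \sum_(k < N.+1) cost v k = gamma ^+ 2 *
    (\sum_(k < N.+1) energy P (v k)) - \sum_(k < N.+1) energy P (z v k).
  by rewrite mulr_sumr -sumrB.
have sum_ge0 (K : hilbertType R) (q : nat -> Omega -> K) :
    0 <= \sum_(k < N.+1) energy P (q k).
  by apply: sumr_ge0 => k _; exact: energy_ge0.
have ratio v (delta : R) : disturbance v -> 0 < \sum_(k < N.+1) energy P (v k) ->
    (L2norm P N (z v) / L2norm P N v <= delta%:E)%E =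
    (Num.sqrt (\sum_(k < N.+1) energy P (z v k)) <=
     delta * Num.sqrt (\sum_(k < N.+1) energy P (v k))).
  move=> vi v0; rewrite (L2normE vi) (L2normE (sqint_perturbation vi)).
  by rewrite inver gt_eqF ?sqrtr_gt0//= lee_pdivrMr ?sqrtr_gt0//.
split=> [lt_gamma|[eps eps0 coer]].
- (* the supremum is -oo when V is trivial *)
  pose delta := fine (maxe (Hinf_norm w A C B1 D1 Cb Db N) 0).
  have [delta0 delta_lt le_delta] : [/\ 0 <= delta, delta < gamma &
      (Hinf_norm w A C B1 D1 Cb Db N <= delta%:E)%E].
    rewrite /delta; case: (Hinf_norm _ _ _ _ _ _ _ _) lt_gamma => [s| |]//=.
    + rewrite lte_fin -EFin_max /= => sg.
      by rewrite le_max lexx orbT gt_max sg gamma_gt0 lee_fin le_max lexx.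
    + by move=> _; rewrite maxNye /= lexx gamma_gt0 leNye.
  exists (gamma ^+ 2 - delta ^+ 2) => [|v vi v0].
    by rewrite subr_gt0 ltr_pXn2r ?nnegrE// ltW.
  have : (L2norm P N (z v) / L2norm P N v <= delta%:E)%E.
    apply: le_trans le_delta; apply: ereal_sup_ubound; exists v => //; split.
      exact/L2P.
    by rewrite (L2normE vi) eqe sqrtr_eq0 leNgt v0.
  rewrite ratio// => h.
  have : \sum_(k < N.+1) energy P (z v k) <=
      delta ^+ 2 * \sum_(k < N.+1) energy P (v k).
    rewrite -(sqr_sqrtr (sum_ge0 _ (z v))) -(sqr_sqrtr (sum_ge0 _ v)) -exprMn.
    by rewrite ler_pXn2r ?nnegrE ?sqrtr_ge0// mulr_ge0// sqrtr_ge0.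
  by rewrite costE mulrBl lerD2l lerN2.
- pose delta := Num.sqrt (gamma ^+ 2 - eps).
  apply: (@le_lt_trans _ _ delta%:E); last first.
    rewrite lte_fin -[ltRHS](ger0_norm (ltW gamma_gt0)) -sqrtr_sqr.
    by rewrite ltr_sqrt ?exprn_gt0// gtrBl.
  apply: ge_ereal_sup => _ [v [/L2P vi v_neq0] <-].
  have v0 : 0 < \sum_(k < N.+1) energy P (v k).
    by move: v_neq0; rewrite (L2normE vi) eqe sqrtr_eq0 ltNge.
  have h : \sum_(k < N.+1) energy P (z v k) <=
      (gamma ^+ 2 - eps) * \sum_(k < N.+1) energy P (v k).
    by have := coer v vi v0; rewrite costE mulrBl; lra.
  have c0 : 0 <= gamma ^+ 2 - eps.
    by rewrite -(pmulr_lge0 _ v0) (le_trans _ h).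
  by rewrite ratio// /delta -sqrtrM// ler_sqrt// mulr_ge0// ltW.
Qed.

Lemma bounded_real_lemma :
  (Hinf_norm w A C B1 D1 Cb Db N < gamma%:E)%E <->
  exists Y : nat -> H -> H,
    [/\ (forall k, (k <= N.+1)%N -> selfadjoint (Y k)),
        Y N.+1 = 0,
        (forall k, (k <= N)%N -> Y k = ric k (Y k.+1)) &
        (forall k, (k <= N)%N -> op_gt0 (p3 k (Y k.+1)))].
Proof.
rewrite Hinf_norm_ltP; split=> [[eps eps0 coer]|[Y [Ysa Yend Yric Ypos]]].
- have [Ysa Ypos] := riccati_solvable eps0 coer.
  exists riccati_sol; split.
  + by move=> k kN; exact: Ysa.
  + exact: riccati_sol_end.
  + exact: riccati_solE.
  + by move=> k kN; exact: Ypos.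
- have [eps eps0 coer] := cost_coercive Ysa Yend Yric Ypos.
  by exists eps => // v vi _; exact: coer.
Qed.

End BoundedReal.

Theorem theorem3 (R : realType) (H V Z : hilbertType R)
  (H_sep : separable H) (V_sep : separable V) (Z_sep : separable Z)
  (d : measure_display) (Omega : measurableType d) (P : probability Omega R)
  (N : nat) (w : nat -> {RV P >-> R})
  (w_moments : orthonormal_noise w N) (w_cond : conditionally_orthonormal w N)
  (A C : nat -> H -> H) (B1 D1 : nat -> V -> H)
  (Cb : nat -> H -> Z) (Db : nat -> V -> Z)
  (A_bd : forall k, (k <= N)%N -> bounded_op (A k))
  (C_bd : forall k, (k <= N)%N -> bounded_op (C k))
  (B1_bd : forall k, (k <= N)%N -> bounded_op (B1 k))
  (D1_bd : forall k, (k <= N)%N -> bounded_op (D1 k))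
  (Cb_bd : forall k, (k <= N)%N -> bounded_op (Cb k))
  (Db_bd : forall k, (k <= N)%N -> bounded_op (Db k))
  (Db_Cb : forall k, (k <= N)%N -> (Db k)^† \o Cb k = 0)
  (gamma : R) (gamma_gt0 : 0 < gamma) :
  (Hinf_norm w A C B1 D1 Cb Db N < gamma%:E)%E <->
  exists Y : nat -> H -> H,
    [/\ (forall k, (k <= N.+1)%N -> selfadjoint (Y k)),
        Y N.+1 = 0,
        (forall k, (k <= N)%N ->
           Y k = pi1 A C Cb (Y k.+1) k
                 - ((pi2 A C B1 D1 (Y k.+1) k)^†
                    \o op_inv (pi3 B1 D1 Db gamma (Y k.+1) k)
                    \o pi2 A C B1 D1 (Y k.+1) k)) &
        (forall k, (k <= N)%N -> op_gt0 (pi3 B1 D1 Db gamma (Y k.+1) k))].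
Proof. exact: bounded_real_lemma. Qed.
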